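(* Suppose an open set $\Omega\subset\mathbb{R}^d$ tiles $\mathbb{R}^d$ with a discrete subgroup $\mathcal{T}$ of $\mathbb{R}^d$. For almost every $x\in\mathbb{R}^d$ there are unique $y(x)\in\Omega$ and $\gamma(x)\in\mathcal{T}$ such that $x=y(x)+\gamma(x)$. Define the operators $\{U(t)\}$ on $L^2(\Omega)$ by $$U(t)f(x)=f(y(x+t))=f(x+t-\gamma(x+t)),\qquad t\in\mathbb{R}^d,\ x\in\Omega,\ f\in L^2(\Omega).$$ Then $\{U(t)\}_{t\in\mathbb{R}^d}$ is a strongly continuous unitary group of local translations. Its Fourier transform is multiplication by $e^{2\pi i\gamma^*\cdot t}$ on the dual set $\mathcal{T}^*$: $$\mathscr{F}U(t)f(\gamma^* )=e^{2\pi i\gamma^*\cdot t}\,\mathscr{F}f(\gamma^* ),\qquad \gamma^*\in\mathcal{T}^*,\ t\in\mathbb{R}^d,\ f\in L^2(\Omega)$$ (equality in $L^2(\nu)$, where $\nu$ is the pair measure of $\Omega$ supported on $\mathcal{T}^*$).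
   Context: $\Omega$ tiles $\mathbb{R}^d$ with $\mathcal{T}$ if $\{\Omega+t:t\in\mathcal{T}\}$ is a partition of $\mathbb{R}^d$ up to Lebesgue measure zero. Dual set: $\mathcal{T}^*=\{\gamma^*\in\mathbb{R}^d:\gamma^*\cdot\gamma\in\mathbb{Z}\text{ for all }\gamma\in\mathcal{T}\}$. Group of local translations on $\Omega$: a strongly continuous group $\{U(t)\}_{t\in\mathbb{R}^d}$ of unitary operators on $L^2(\Omega)$ such that for every open subset $V$ of $\Omega$ and every $t\in\mathbb{R}^d$ with $V+t\subset\Omega$, $(U(t)f)(x)=f(x+t)$ for a.e. $x\in V$ and all $f\in L^2(\Omega)$. Pair measure: a positive Radon measure $\nu$ on $\mathbb{R}^d$ is a pair measure for $\Omega$ if for each $f\in L^1(\Omega)\cap L^2(\Omega)$ the function $\hat f(\lambda)=\int_\Omega f(x)e^{-2\pi i\lambda\cdot x}dx$ satisfies $\int|\hat f|^2d\nu<\infty$ and $f\mapsto\hat f$ from $L^1(\Omega)\cap L^2(\Omega)\subset L^2(\Omega)$ into $L^2(\nu)$ is isometric with dense range; $\mathscr{F}:L^2(\Omega)\to L^2(\nu)$ is the isometric isomorphism extending it by continuity. Every discrete subgroup of $\mathbb{R}^d$ has the form $\mathcal{T}=A(\mathbb{Z}^{d_1}\times\{0\})$ with $A$ an invertible real $d\times d$ matrix and $d=d_1+d_2$. Here $\nu$ is the measure $\nu(E)=|\det(A^T)^{-1}|\,(\delta_{\mathbb{Z}^{d_1}}\times\mathfrak{m}_{d_2})(A^TE)$,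 with $\delta_{\mathbb{Z}^{d_1}}$ the counting measure on $\mathbb{Z}^{d_1}\subset\mathbb{R}^{d_1}$ and $\mathfrak{m}_{d_2}$ Lebesgue measure on $\mathbb{R}^{d_2}$; it is supported on $\mathcal{T}^*$ and is a pair measure for $\Omega$ when $\Omega$ tiles with $\mathcal{T}$. *)

(* Defs.v *)
From HB Require Import structures.
From mathcomp Require Import all_boot all_order all_algebra.
From mathcomp Require Import complex.
From mathcomp Require Import all_classical all_reals all_analysis.
From mathcomp Require Import measurable_realfun.

Set Implicit Arguments.
Unset Strict Implicit.
Unset Printing Implicit Defensive.
Import Order.TTheory GRing.Theory Num.Theory.
Import numFieldNormedType.Exports.
Import complex.ComplexField.Normc.

Local Open Scope classical_set_scope.
Local Open Scope ring_scope.

(* R^n is 'cV[R]_n with the topology of the library (the product topology) and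
   its Borel sigma-algebra. *)
Definition borel_display : measure_display.
Proof. exact: default_measure_display. Qed.

Section borel.
Context (R : realType) (n : nat).

Let borel0 : <<s @open 'cV[R]_n >> set0.
Proof. exact: sigma_algebra0. Qed.

Let borelC A : <<s @open 'cV[R]_n >> A -> <<s @open 'cV[R]_n >> (~` A).
Proof. exact: sigma_algebraC. Qed.

Let borel_bigcup (F : (set 'cV[R]_n)^nat) :
  (forall i, <<s @open 'cV[R]_n >> (F i)) ->
  <<s @open 'cV[R]_n >> (\bigcup_i F i).
Proof. exact: sigma_algebra_bigcup. Qed.

HB.instance Definition _ := @isMeasurable.Build borel_display 'cV[R]_n
  <<s @open 'cV[R]_n >> borel0 borelC borel_bigcup.

End borel.

Lemma open_measurable_cV (R : realType) n (U : set 'cV[R]_n) :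
  open U -> measurable U.
Proof. exact: sub_sigma_algebra. Qed.

Lemma measurable_coord (R : realType) n (i : 'I_n) :
  measurable_fun setT (fun x : 'cV[R]_n => x i 0).
Proof.
apply: (measurability _ (RGenOpens.measurableE R)).
move=> _ [_ [a [b ->] <-]]; rewrite setTI; apply: open_measurable_cV.
apply: open_comp; last exact: interval_open.
by move=> x _; exact: coord_continuous.
Qed.

Lemma measurable_fun_cV d (T : measurableType d) (R : realType) n
    (f : T -> 'cV[R]_n) :
  (forall i, measurable_fun setT (fun x => f x i 0)) -> measurable_fun setT f.
Proof.
move=> mf; apply: (measurability (@open 'cV[R]_n)) => //.
move=> _ [U oU <-]; rewrite setTI.
pose B (c : 'cV[rat]_n * nat) : set 'cV[R]_n :=
  [set y | forall i, `|y i 0 - ratr (c.1 i 0)| < c.2.+1%:R^-1].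
have -> : U = \bigcup_(c in [set c | B c `<=` U]) B c.
  apply/seteqP; split=> [x Ux|x [c cU]]; last exact: cU.
  have /nbhs_ballP[e /= e0 eU] : nbhs x U by exact: open_nbhs_nbhs.
  have e20 : 0 < e / 2 by rewrite divr_gt0.
  have [k] := ltr_add_invr e20; rewrite add0r => ke.
  have k0 : 0 < k.+1%:R^-1 :> R by rewrite invr_gt0.
  have /choice[q qP] (i : 'I_n) : exists q : rat, `|x i 0 - ratr q| < k.+1%:R^-1.
    have [|q] := @rat_in_itvoo R (x i 0 - k.+1%:R^-1) (x i 0 + k.+1%:R^-1).
      by rewrite ltrD2l gtrN.
    rewrite in_itv/= => /andP[q1 q2]; exists q.
    by rewrite ltr_distlC q1 q2.
  exists (\col_i q i, k) => /=; last by move=> i; rewrite mxE.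
  move=> y yB; apply: eU; split=> // i j; rewrite ord1 /ball/=.
  have := yB i; rewrite /= mxE => yq.
  rewrite -(subrK (ratr (q i)) (x i 0)) -addrA.
  apply: le_lt_trans (ler_normD _ _) _.
  rewrite (splitr e) ltrD//; first exact: lt_trans (qP i) ke.
  by rewrite distrC; exact: lt_trans yq ke.
rewrite preimage_bigcup bigcup_mkcond.
apply: countable_bigcupT_measurable => [|c]; first exact: countableP.
case: ifPn => // _.
rewrite (_ : f @^-1` B c = \bigcap_(i in [set: 'I_n])
    ((fun x => f x i 0) @^-1` [set y | `|y - ratr (c.1 i 0)| < c.2.+1%:R^-1])).
  apply: fin_bigcap_measurable; first exact: finite_finset.
  move=> i _; rewrite -[X in measurable X]setTI; apply: mf => //.
  rewrite (_ : [set y | _] = ball (ratr (c.1 i 0) : R) c.2.+1%:R^-1).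
    by apply: open_measurable; exact: ball_open.
  by apply/seteqP; split=> y /=; rewrite /ball/= distrC.
by apply/seteqP; split=> [x /= xB i _|x /= xB i]; exact: xB.
Qed.

Section lebesgue_step.
Context (R : realType) (n : nat).
Variable mu : {sigma_finite_measure set 'cV[R]_n -> \bar R}.

Definition cons_cV (p : measurableTypeR R * 'cV[R]_n) : 'cV[R]_n.+1 :=
  col_mx (p.1)%:M p.2.

Definition uncons_cV (v : 'cV[R]_n.+1) : measurableTypeR R * 'cV[R]_n :=
  (v ord0 0, \col_i v (lift ord0 i) 0).

Lemma cons_cV0 p : cons_cV p ord0 0 = p.1.
Proof.
rewrite mxE; case: splitP => // j _.
by rewrite !ord1 mxE eqxx mulr1n.
Qed.

Lemma cons_cVS p i : cons_cV p (lift ord0 i) 0 = p.2 i 0.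
Proof.
rewrite mxE; case: splitP => [j|j [ij]]; first by rewrite ord1.
by congr (p.2 _ _); exact/val_inj.
Qed.

Lemma cons_cVK : cancel cons_cV uncons_cV.
Proof.
move=> [r v]; rewrite /uncons_cV cons_cV0; congr pair.
by apply/matrixP => i j; rewrite mxE cons_cVS ord1.
Qed.

Lemma uncons_cVK : cancel uncons_cV cons_cV.
Proof.
move=> v; apply/matrixP => i j; rewrite ord1.
by case: (unliftP ord0 i) => [k|] ->; rewrite ?cons_cV0 ?cons_cVS //= mxE.
Qed.

Lemma measurable_cons_cV : measurable_fun setT cons_cV.
Proof.
apply: measurable_fun_cV => i; case: (unliftP ord0 i) => [k|] ->.
  under eq_fun do rewrite cons_cVS.
  exact: measurableT_comp (measurable_coord k) measurable_snd.
under eq_fun do rewrite cons_cV0.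
exact: measurable_fst.
Qed.

Lemma measurable_uncons_cV : measurable_fun setT uncons_cV.
Proof.
apply: measurable_fun_pair; first exact: measurable_coord.
apply: measurable_fun_cV => i; under eq_fun do rewrite mxE.
exact: measurable_coord.
Qed.

Definition lebesgue_cons : set 'cV[R]_n.+1 -> \bar R :=
  pushforward (lebesgue_measure \x mu)%E cons_cV.

HB.instance Definition _ := Measure.copy lebesgue_cons
  (Measure.clone _ _ _ (pushforward (lebesgue_measure \x mu)%E cons_cV)
    (measure_function_pushforward__canonical__measure_function_Measure
       (lebesgue_measure \x mu)%E measurable_cons_cV)).

Let lebesgue_cons_sigma_finite : sigma_finite setT lebesgue_cons.
Proof.
have /sigma_finiteP[F [FT ndF Foo]] := sigma_finiteT (@lebesgue_measure R).
have /sigma_finiteP[G [GT ndG Goo]] := sigma_finiteT mu.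
exists (fun k => uncons_cV @^-1` (F k `*` G k)).
  rewrite -preimage_bigcup; apply/seteqP; split=> // v _ /=.
  have : [set: R] (uncons_cV v).1 by [].
  have : [set: 'cV[R]_n] (uncons_cV v).2 by [].
  rewrite FT GT => -[j _ Gj] [i _ Fi]; exists (maxn i j) => //; split.
    by move: Fi; exact/subsetPset/ndF/leq_maxl.
  by move: Gj; exact/subsetPset/ndG/leq_maxr.
move=> k; have [mF ?] := Foo k; have [mG ?] := Goo k; split.
  rewrite -[X in measurable X]setTI; apply: measurable_uncons_cV => //.
  exact: measurableX.
rewrite /lebesgue_cons /pushforward -comp_preimage.
rewrite (_ : _ \o _ = id); last by apply/funext => p; exact: cons_cVK.
by rewrite product_measure1E// lte_mul_pinfty// ge0_fin_numE.
Qed.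

HB.instance Definition _ :=
  Measure_isSigmaFinite.Build _ _ _ lebesgue_cons lebesgue_cons_sigma_finite.

End lebesgue_step.

(* Lebesgue measure on R^n, as the n-fold product of the one on R
   (see [lebesgue_cV_box]). *)
Fixpoint lebesgue_cV (R : realType) (n : nat) :
    {sigma_finite_measure set 'cV[R]_n -> \bar R} :=
  match n with
  | 0 => \d_(0 : 'cV[R]_0)
  | m.+1 => lebesgue_cons (lebesgue_cV R m)
  end.

Lemma lebesgue_cV_box (R : realType) n (I : 'I_n -> set R) :
  (forall i, measurable (I i)) ->
  lebesgue_cV R n [set x | forall i, I i (x i 0)] =
  (\prod_(i < n) lebesgue_measure (I i))%E.
Proof.
elim: n I => [|n IHn] I mI.
  rewrite big_ord0 /= /dirac indicE mem_set//= => -[].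
  by [].
rewrite big_ord_recl -IHn//=.
have mB : measurable [set x : 'cV[R]_n | forall i, I (lift ord0 i) (x i 0)].
  rewrite (_ : [set x | _] = \bigcap_(i in [set: 'I_n])
      ((fun x : 'cV[R]_n => x i 0) @^-1` I (lift ord0 i))).
    apply: fin_bigcap_measurable; first exact: finite_finset.
    move=> i _; rewrite -[X in measurable X]setTI.
    exact: (measurable_coord i).
  by apply/seteqP; split=> [x /= xI i _|x /= xI i]; exact: xI.
rewrite -[RHS](product_measure1E lebesgue_measure (lebesgue_cV R n) (mI ord0) mB).
rewrite /lebesgue_cons /pushforward; congr product_measure1.
apply/seteqP; split=> p /= pI.
  by split=> [|i]; [rewrite -cons_cV0|rewrite -cons_cVS]; exact: pI.
move=> i; case: (unliftP ord0 i) => [k|] ->.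
  by rewrite cons_cVS; case: pI => _; exact.
by rewrite cons_cV0; case: pI.
Qed.

Section spaces.
Context d (T : measurableType d) (R : realType).
Implicit Types (mu : {measure set T -> \bar R}) (D : set T) (f g : T -> R[i]).

Definition cmeasurable D f :=
  measurable_fun D (fun x => complex.Re (f x)) /\
  measurable_fun D (fun x => complex.Im (f x)).

Definition cintegral mu D f : R[i] :=
  Complex (\int[mu]_(x in D) complex.Re (f x))
          (\int[mu]_(x in D) complex.Im (f x)).

Definition cLnorm mu (p : \bar R) D f : \bar R :=
  Lnorm mu p ((fun x => (normc (f x))%:E) \_ D).

(* Elements of L^p(D, mu) are represented by functions on the whole of T, of
   which only the values on D matter; their equality in L^p(D, mu) is
   [f = g %[ae mu in D]]. *)
Definition cLp mu (p : \bar R) D : set (T -> R[i]) :=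
  [set f | cmeasurable D f /\ (cLnorm mu p D f < +oo)%E].

Definition L2inner mu D f g : R[i] :=
  cintegral mu D (fun x => f x * conjc (g x)).

End spaces.

Section operators.
Context d d' (T : measurableType d) (T' : measurableType d') (R : realType).
Variables (mu : {measure set T -> \bar R}) (D : set T).
Variables (nu : {measure set T' -> \bar R}) (E : set T').
Implicit Type F : (T -> R[i]) -> (T' -> R[i]).

Record L2_linear F : Prop := {
  L2_linear_range : forall f, cLp mu 2%:E D f -> cLp nu 2%:E E (F f) ;
  L2_linear_ae : forall f g, cLp mu 2%:E D f -> cLp mu 2%:E D g ->
    f = g %[ae mu in D] -> F f = F g %[ae nu in E] ;
  L2_linear_comb : forall (a : R[i]) f g,
    cLp mu 2%:E D f -> cLp mu 2%:E D g ->
    F (fun x => a * f x + g x) = (fun y => a * F f y + F g y)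
      %[ae nu in E] }.

Definition L2_onto F := forall g, cLp nu 2%:E E g ->
  exists2 f, cLp mu 2%:E D f & F f = g %[ae nu in E].

Record isometric_isomorphism F : Prop := {
  isometric_isomorphism_linear : L2_linear F ;
  isometric_isomorphism_norm : forall f, cLp mu 2%:E D f ->
    cLnorm nu 2%:E E (F f) = cLnorm mu 2%:E D f ;
  isometric_isomorphism_onto : L2_onto F }.

End operators.

Record unitary d (T : measurableType d) (R : realType)
    (mu : {measure set T -> \bar R}) (D : set T)
    (F : (T -> R[i]) -> (T -> R[i])) : Prop := {
  unitary_linear : L2_linear mu D mu D F ;
  unitary_inner : forall f g, cLp mu 2%:E D f -> cLp mu 2%:E D g ->
    L2inner mu D (F f) (F g) = L2inner mu D f g ;
  unitary_onto : L2_onto mu D mu D F }.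

Section tilings.
Context (R : realType) (d : nat).
Local Notation leb := (lebesgue_cV R d).
Implicit Types (Omega T : set 'cV[R]_d) (x t : 'cV[R]_d).

Definition dot x t : R := \sum_(i < d) x i 0 * t i 0.

(* e^(2 pi i a) *)
Definition cis (a : R) : R[i] := Complex (cos (2 * pi * a)) (sin (2 * pi * a)).

Record discrete_subgroup T : Prop := {
  discrete_subgroup0 : T 0 ;
  discrete_subgroupB : forall x y, T x -> T y -> T (x - y) ;
  discrete_subgroup_isolated : T `<=` isolated T }.

Definition translate Omega t : set 'cV[R]_d := [set x + t | x in Omega].

Definition tiles Omega T :=
  (forall s t, T s -> T t -> s <> t ->
    leb.-negligible (translate Omega s `&` translate Omega t)) /\
  leb.-negligible (~` \bigcup_(t in T) translate Omega t).

Definition dual_set T : set 'cV[R]_d :=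
  [set l | forall g, T g -> dot l g \is a Num.int].

(* The y(x) and gamma(x) of x = y(x) + gamma(x); where no such decomposition
   exists, y(x) takes the default value 0. *)
Definition tile_point Omega T x : 'cV[R]_d :=
  xget 0 [set y | Omega y /\ T (x - y)].

Definition tile_shift Omega T x : 'cV[R]_d := x - tile_point Omega T x.

Definition tile_translation Omega T t (f : 'cV[R]_d -> R[i]) :
    'cV[R]_d -> R[i] :=
  fun x => f (tile_point Omega T (x + t)).

Record local_translation_group Omega
    (U : 'cV[R]_d -> ('cV[R]_d -> R[i]) -> ('cV[R]_d -> R[i])) : Prop := {
  ltg_unitary : forall t, unitary leb Omega (U t) ;
  ltg0 : forall f, cLp leb 2%:E Omega f -> U 0 f = f %[ae leb in Omega] ;
  ltgD : forall s t f, cLp leb 2%:E Omega f ->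
    U (s + t) f = U s (U t f) %[ae leb in Omega] ;
  ltg_strongly_continuous : forall f t0, cLp leb 2%:E Omega f ->
    cLnorm leb 2%:E Omega (fun x => U t f x - U t0 f x) @[t --> t0] --> 0%E ;
  ltg_local : forall V t f, open V -> V `<=` Omega ->
    translate V t `<=` Omega -> cLp leb 2%:E Omega f ->
    U t f = (fun x => f (x + t)) %[ae leb in V] }.

Definition fourier_integral Omega (f : 'cV[R]_d -> R[i]) : 'cV[R]_d -> R[i] :=
  fun l => cintegral leb Omega (fun x => f x * cis (- dot l x)).

(* The transform F : L^2(Omega) -> L^2(nu) of a pair measure nu.  It exists when
   f |-> fourier_integral Omega f, on the dense subspace L^1 /\ L^2, is isometric
   with dense range, and is then determined up to nu-a.e. equality. *)
Record pair_transform Omega (nu : {measure set 'cV[R]_d -> \bar R})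
    (F : ('cV[R]_d -> R[i]) -> ('cV[R]_d -> R[i])) : Prop := {
  pair_transform_iso : isometric_isomorphism leb Omega nu setT F ;
  pair_transform_integral : forall f,
    cLp leb 1%:E Omega f -> cLp leb 2%:E Omega f ->
    F f = fourier_integral Omega f %[ae nu] }.

End tilings.

Definition integer_points (R : realType) n : set 'cV[R]_n :=
  [set z | forall i, z i 0 \is a Num.int].

Lemma measurable_integer_points (R : realType) n :
  measurable (@integer_points R n).
Proof.
have mZ : measurable [set r : R | r \is a Num.int].
  rewrite (_ : [set r | _] = range (fun m : int => m%:~R)).
    apply: countable_measurable => //.
    exact: sub_countable (card_image_le _ _) (countableP _).
  by apply/seteqP; split=> [r /intrP[m ->]|_ [m _ <-]] /=; [exists m|].
rewrite (_ : @integer_points R n = \bigcap_(i in [set: 'I_n])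
    ((fun z : 'cV[R]_n => z i 0) @^-1` [set r | r \is a Num.int])).
  apply: fin_bigcap_measurable; first exact: finite_finset.
  by move=> i _; rewrite -[X in measurable X]setTI; exact: measurable_coord.
by apply/seteqP; split=> [z /= zZ i _|z /= zZ i]; exact: zZ.
Qed.


Section lattice.
Context (R : realType) (d d1 d2 : nat) (e : (d1 + d2)%N = d) (A : 'M[R]_d).

Definition join_cV (p : 'cV[R]_d1 * 'cV[R]_d2) : 'cV[R]_d :=
  castmx (e, erefl) (col_mx p.1 p.2).

Definition lattice : set 'cV[R]_d :=
  [set A *m join_cV (z, 0) | z in @integer_points R d1].

Definition integer_lebesgue :
    {measure set ('cV[R]_d1 * 'cV[R]_d2)%type -> \bar R} :=
  (mrestr counting (@measurable_integer_points R d1)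
    \x lebesgue_cV R d2)%E.

(* nu(E) = |det (A^T)^-1| (delta x m)(A^T E), with the set A^T E written as the
   preimage of E under (A^T)^-1 (see [lattice_measureE]). *)
Definition lattice_measure (E : set 'cV[R]_d) : \bar R :=
  (`|\det (invmx A^T)|%:E *
   integer_lebesgue [set p | E (invmx A^T *m join_cV p)])%E.

Let dual_map (p : 'cV[R]_d1 * 'cV[R]_d2) : 'cV[R]_d := invmx A^T *m join_cV p.

Let measurable_dual_map : measurable_fun setT dual_map.
Proof.
apply: measurable_fun_cV => i; under eq_fun do rewrite mxE.
apply: measurable_sum => j; apply: measurable_funM => //.
under eq_fun do rewrite castmxE mxE.
case: splitP => k _.
- rewrite (_ : cast_ord _ 0 = 0); last exact/val_inj.
  exact: measurableT_comp (measurable_coord k) measurable_fst.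
- rewrite (_ : cast_ord _ 0 = 0); last exact/val_inj.
  exact: measurableT_comp (measurable_coord k) measurable_snd.
Qed.

Let mdual_map (E : set 'cV[R]_d) :
  measurable E -> measurable (dual_map @^-1` E).
Proof.
by move=> mE; rewrite -[X in measurable X]setTI; exact: measurable_dual_map.
Qed.

Let lattice_measure0 : lattice_measure set0 = 0%E.
Proof. by rewrite /lattice_measure (measure0 integer_lebesgue) mule0. Qed.

Let lattice_measure_ge0 E : (0 <= lattice_measure E)%E.
Proof. by rewrite /lattice_measure mule_ge0// lee_fin. Qed.

Let lattice_measure_sigma_additive : semi_sigma_additive lattice_measure.
Proof.
move=> F mF tF mUF; rewrite /lattice_measure.
under eq_fun do rewrite -ge0_sume_distrr//.
apply: cvgeZl => //.
rewrite -/(dual_map @^-1` _) preimage_bigcup.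
apply: (@measure_semi_sigma_additive _ _ _ integer_lebesgue
  (fun k => dual_map @^-1` F k)).
- by move=> k; exact: mdual_map.
- apply/trivIsetP => i j _ _ ij; rewrite -preimage_setI.
  by move/trivIsetP : tF => -> //; rewrite preimage_set0.
- by rewrite -preimage_bigcup; exact: mdual_map.
Qed.

HB.instance Definition _ := isMeasure.Build _ _ _ lattice_measure
  lattice_measure0 lattice_measure_ge0 lattice_measure_sigma_additive.

Lemma lattice_measureE (E : set 'cV[R]_d) : A \in unitmx ->
  lattice_measure E =
  (`|\det (invmx A^T)|%:E *
   integer_lebesgue (join_cV @^-1` (mulmx A^T @` E)))%E.
Proof.
rewrite -unitmx_tr => uA; congr (_ * integer_lebesgue _)%E.
apply/seteqP; split=> [p /= Ep|p /= [v Ev vE]].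
  by exists (invmx A^T *m join_cV p); rewrite // mulKVmx.
by rewrite -vE mulKmx.
Qed.

End lattice.

(* Main.v *)
Require Import Defs.
From mathcomp Require Import all_boot all_order all_algebra.
From mathcomp Require Import complex.
From mathcomp Require Import all_classical all_reals all_analysis.
From mathcomp Require Import measurable_realfun ring lra.
Set Implicit Arguments.
Unset Strict Implicit.
Unset Printing Implicit Defensive.
Import Order.TTheory GRing.Theory Num.Theory.
Import numFieldNormedType.Exports.
Import complex.ComplexField.Normc.
Local Open Scope classical_set_scope.
Local Open Scope ring_scope.

(** Two distinct translates [Omega + s] and [Omega + t] meet in an open null set, hence
    not at all: the decomposition [x = y(x) + gamma(x)] is unique wherever it
    exists, and it exists off a closed null set.  The translates being disjoint,
    nonempty and open, there are countably many of them.

    Everything about [U t] then follows from one fact: the map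
    [phi_t : x |-> y(x + t)] preserves Lebesgue measure on [Omega].  Indeed
    [Omega] is, up to null sets, the disjoint union over [g] in [T] of the pieces
    on which [phi_t] is the translation by [t - g], and also the disjoint union
    of the images of these pieces, because [- T = T].  So composition with
    [phi_t] preserves all integrals over [Omega]
    ([preserves_measure_tile_shift], [integral_preserving]).  The group law
    comes from the [T]-periodicity of [y], so [U t] has the inverse [U (- t)]
    and is unitary, and [U t] is local because [y] is the identity on [Omega].

    Strong continuity and the Fourier identity are both proved on a simple class
    of functions and extended to [L^2] by a single density principle
    ([cLp2_ind]): a property of square integrable functions that is stable under
    linear combinations and [L^2] limits holds for all of them as soon as it
    holds for indicators of sets of finite measure.

    For strong continuity, indicators of open sets are treated first: if [V] is
    open of finite measure, most points of [V] stay in [V] under all small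
    translations, and the part of [phi_t^-1 V] outside [V] has the same measure
    as the part of [V] outside [phi_t^-1 V].  A Dynkin class argument passes to
    Borel sets.

    For the Fourier identity, an indicator lies in [L^1] and [L^2], so its
    transform is an integral.  If [l] is in the dual set, the character
    [x |-> e^(-2 pi i l . x)] takes the same value at [x + t] and [y(x + t)];
    substituting [phi_t] in the integral therefore only brings out the factor
    [e^(2 pi i l . t)].  Stability under limits uses that [F] is isometric and
    that this factor has modulus one.  Finally, [nu] lives on the dual set
    because [l] is dual to [A (Z^d1 x 0)] as soon as the first [d1] coordinates
    of [A^T l] are integers. *)

(** * Complex-valued functions and their squared L2 norms *)

Section sqnorm.
Context (R : realType).
Implicit Types z w : R[i].

Definition sqnorm z : R := complex.Re z ^+ 2 + complex.Im z ^+ 2.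

Lemma sqnorm_ge0 z : 0 <= sqnorm z.
Proof. by rewrite addr_ge0// sqr_ge0. Qed.

Lemma sqr_normc_sqnorm z : normc z ^+ 2 = sqnorm z.
Proof. by case: z => a b; rewrite /normc sqr_sqrtr// addr_ge0// sqr_ge0. Qed.

Lemma normc_ge0 z : 0 <= normc z.
Proof. by case: z => a b; exact: sqrtr_ge0. Qed.

Lemma sqnormM z w : sqnorm (z * w) = sqnorm z * sqnorm w.
Proof. by case: z w => [a b] [c e]; rewrite /sqnorm/=; ring. Qed.

Lemma sqnormD z w : sqnorm (z + w) <= 2 * sqnorm z + 2 * sqnorm w.
Proof.
rewrite -subr_ge0 (_ : _ - _ = sqnorm (z - w)) ?sqnorm_ge0//.
by case: z w => [a b] [c e]; rewrite /sqnorm/=; ring.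
Qed.

Lemma sqnormN z : sqnorm (- z) = sqnorm z.
Proof. by case: z => [a b]; rewrite /sqnorm/=; ring. Qed.

Lemma sqnorm0 : sqnorm 0 = 0.
Proof. by rewrite /sqnorm/= expr0n/= addr0. Qed.

Lemma sqnorm_eq0 z : sqnorm z = 0 -> z = 0.
Proof.
case: z => a b; rewrite /sqnorm/= => /eqP.
rewrite paddr_eq0 ?sqr_ge0// !sqrf_eq0 => /andP[/eqP-> /eqP->].
by [].
Qed.

Lemma complexReM z w : complex.Re (z * w) =
  complex.Re z * complex.Re w - complex.Im z * complex.Im w.
Proof. by case: z w => [a b] [c e]. Qed.

Lemma complexImM z w : complex.Im (z * w) =
  complex.Re z * complex.Im w + complex.Im z * complex.Re w.
Proof. by case: z w => [a b] [c e]. Qed.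

Lemma complexReD z w : complex.Re (z + w) = complex.Re z + complex.Re w.
Proof. by case: z w => [a b] [c e]. Qed.

Lemma complexImD z w : complex.Im (z + w) = complex.Im z + complex.Im w.
Proof. by case: z w => [a b] [c e]. Qed.

Lemma complexReN z : complex.Re (- z) = - complex.Re z.
Proof. by case: z => [a b]. Qed.

Lemma complexImN z : complex.Im (- z) = - complex.Im z.
Proof. by case: z => [a b]. Qed.

End sqnorm.

Section cmeasurable_arith.
Context d (T : measurableType d) (R : realType) (D : set T).
Implicit Types f g : T -> R[i].

Lemma cmeasurableD f g : cmeasurable D f -> cmeasurable D g ->
  cmeasurable D (fun x => f x + g x).
Proof.
move=> [f1 f2] [g1 g2]; split.
- under eq_fun do rewrite complexReD; exact: measurable_funD.
- under eq_fun do rewrite complexImD; exact: measurable_funD.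
Qed.

Lemma cmeasurableN f : cmeasurable D f -> cmeasurable D (fun x => - f x).
Proof.
move=> [f1 f2]; split.
- under eq_fun do rewrite complexReN; exact: measurableT_comp.
- under eq_fun do rewrite complexImN; exact: measurableT_comp.
Qed.

Lemma cmeasurableB f g : cmeasurable D f -> cmeasurable D g ->
  cmeasurable D (fun x => f x - g x).
Proof. by move=> mf mg; apply: cmeasurableD => //; exact: cmeasurableN. Qed.

Lemma cmeasurableM f g : cmeasurable D f -> cmeasurable D g ->
  cmeasurable D (fun x => f x * g x).
Proof.
move=> [f1 f2] [g1 g2]; split.
- under eq_fun do rewrite complexReM.
  by apply: measurable_funB; exact: measurable_funM.
- under eq_fun do rewrite complexImM.
  by apply: measurable_funD; exact: measurable_funM.
Qed.

Lemma cmeasurable_cst (z : R[i]) : cmeasurable D (fun=> z).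
Proof. by split; exact: measurable_cst. Qed.

Lemma measurable_sqnorm f : cmeasurable D f ->
  measurable_fun D (fun x => sqnorm (f x)).
Proof.
by move=> [f1 f2]; apply: measurable_funD; exact: measurable_funX.
Qed.

Lemma measurable_normc f : cmeasurable D f ->
  measurable_fun D (fun x => normc (f x)).
Proof.
move=> mf; rewrite (_ : (fun x => _) = Num.sqrt \o (fun x => sqnorm (f x))).
  by apply: measurableT_comp; [apply: continuous_measurable_fun; exact: sqrt_continuous|exact: measurable_sqnorm].
by apply/funext => x /=; rewrite -sqr_normc_sqnorm sqrtr_sqr ger0_norm// normc_ge0.
Qed.

Lemma cmeasurable_conjc f : cmeasurable D f ->
  cmeasurable D (fun x => conjc (f x)).
Proof.
move=> [f1 f2]; split.
- by rewrite (_ : (fun x => _) = (fun x => complex.Re (f x)))//;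
    apply/funext => x; case: (f x).
- rewrite (_ : (fun x => _) = (fun x => - complex.Im (f x))).
    exact: measurableT_comp.
  by apply/funext => x; case: (f x).
Qed.

End cmeasurable_arith.

Section L2sq.
Context d (T : measurableType d) (R : realType).
Variables (mu : {measure set T -> \bar R}) (D : set T) (mD : measurable D).
Implicit Types f g : T -> R[i].

(** Working with the square of the norm avoids roots: it is an integral, and the
    triangle inequality is replaced by [L2sqD], whose factor 2 is harmless in
    density arguments. *)
Definition L2sq f : \bar R := (\int[mu]_(x in D) (sqnorm (f x))%:E)%E.

Lemma L2sq_ge0 f : (0 <= L2sq f)%E.
Proof. by apply: integral_ge0 => x _; rewrite lee_fin sqnorm_ge0. Qed.

Lemma sqr_cLnorm2 f : (cLnorm mu 2%:E D f `^ 2)%E = L2sq f.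
Proof.
rewrite /cLnorm poweR_Lnorm// /L2sq [RHS]integral_mkcond.
apply: eq_integral => x _; rewrite /patch; case: ifPn => _.
  by rewrite gee0_abs ?lee_fin ?normc_ge0// poweR_EFin powR_mulrn ?normc_ge0//
     sqr_normc_sqnorm.
by rewrite abse0 poweR0r.
Qed.

Lemma cLnorm2E f : cLnorm mu 2%:E D f = (L2sq f `^ 2^-1)%E.
Proof.
rewrite -sqr_cLnorm2 -poweRrM divff// poweRe1//.
exact: Lnorm_ge0.
Qed.

Lemma cLnorm1E f :
  cLnorm mu 1%:E D f = (\int[mu]_(x in D) (normc (f x))%:E)%E.
Proof.
rewrite /cLnorm Lnorm1 [RHS]integral_mkcond; apply: eq_integral => x _.
rewrite /patch; case: ifPn => _; last by rewrite abse0.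
by rewrite gee0_abs// lee_fin normc_ge0.
Qed.

Lemma cLp2P f : cLp mu 2%:E D f <-> cmeasurable D f /\ (L2sq f < +oo)%E.
Proof.
rewrite /cLp/= cLnorm2E; split=> -[mf f2]; split=> //.
  rewrite -(@poweRe1 _ (L2sq f)) ?L2sq_ge0// -(@mulVf _ (2 : R))// poweRrM.
  by rewrite poweR_lty//.
by rewrite poweR_lty.
Qed.

Lemma measurable_EFin_sqnorm f : cmeasurable D f ->
  measurable_fun D (fun x => (sqnorm (f x))%:E).
Proof. by move=> mf; apply/measurable_EFinP; exact: measurable_sqnorm. Qed.

Lemma L2sqD f g : cmeasurable D f -> cmeasurable D g ->
  (L2sq (fun x => (f x + g x)%R) <= 2%:E * L2sq f + 2%:E * L2sq g)%E.
Proof.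
move=> mf mg.
have mf' := measurable_EFin_sqnorm mf; have mg' := measurable_EFin_sqnorm mg.
have mg2 := measurable_EFin_sqnorm (cmeasurableD mf mg).
rewrite -!ge0_integralZl//; try by move=> x _; rewrite lee_fin sqnorm_ge0.
rewrite -ge0_integralD//; last 4 first.
- by move=> x _; rewrite mule_ge0// lee_fin sqnorm_ge0.
- exact: measurable_funeM.
- by move=> x _; rewrite mule_ge0// lee_fin sqnorm_ge0.
- exact: measurable_funeM.
apply: ge0_le_integral => //.
- by move=> x _; rewrite lee_fin sqnorm_ge0.
- by apply: emeasurable_funD; exact: measurable_funeM.
- by move=> x _; rewrite -!EFinM -EFinD lee_fin sqnormD.
Qed.

Lemma L2sqZ (a : R[i]) f : cmeasurable D f ->
  L2sq (fun x => a * f x) = ((sqnorm a)%:E * L2sq f)%E.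
Proof.
move=> mf; have mf' := measurable_EFin_sqnorm mf.
rewrite -ge0_integralZl//; first last.
- by rewrite lee_fin sqnorm_ge0.
- by move=> x _; rewrite lee_fin sqnorm_ge0.
by apply: eq_integral => x _; rewrite sqnormM EFinM.
Qed.

Lemma eq_L2sq f g : (forall x, D x -> f x = g x) -> L2sq f = L2sq g.
Proof.
by move=> fg; apply: eq_integral => x /set_mem Dx; rewrite fg.
Qed.

Lemma ae_eq_L2sq f g : cmeasurable D f -> cmeasurable D g ->
  f = g %[ae mu in D] -> L2sq f = L2sq g.
Proof.
move=> mf mg fg; apply: ge0_ae_eq_integral => //.
- exact: measurable_EFin_sqnorm.
- exact: measurable_EFin_sqnorm.
- by move=> x _; rewrite lee_fin sqnorm_ge0.
- by move=> x _; rewrite lee_fin sqnorm_ge0.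
- by apply: filterS fg => x fg /fg ->.
Qed.

Lemma L2sq_eq0 f : cmeasurable D f -> L2sq f = 0%E ->
  f = (fun=> 0) %[ae mu in D].
Proof.
move=> mf f0.
have /(ae_eq_integral_abs mu mD (measurable_EFin_sqnorm mf)) :
    (\int[mu]_(x in D) `|(sqnorm (f x))%:E| = 0)%E.
  rewrite -f0; apply: eq_integral => x _.
  by rewrite gee0_abs// lee_fin sqnorm_ge0.
apply: filterS => x h /h [/sqnorm_eq0]; exact.
Qed.

Lemma cLp2_comb (a : R[i]) f g : cLp mu 2%:E D f -> cLp mu 2%:E D g ->
  cLp mu 2%:E D (fun x => a * f x + g x).
Proof.
move=> /cLp2P[mf f2] /cLp2P[mg g2]; apply/cLp2P.
have maf : cmeasurable D (fun x => a * f x).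
  exact: (cmeasurableM (cmeasurable_cst D a) mf).
split; first exact: cmeasurableD.
apply: le_lt_trans (L2sqD maf mg) _; rewrite L2sqZ//.
by rewrite lte_add_pinfty// ?lte_mul_pinfty// ?mule_ge0 ?L2sq_ge0 ?lee_fin
   ?sqnorm_ge0.
Qed.

Lemma cLp2_0 : cLp mu 2%:E D (fun=> 0 : R[i]).
Proof.
apply/cLp2P; split; first exact: cmeasurable_cst.
by rewrite /L2sq; under eq_integral do rewrite sqnorm0; rewrite integral0.
Qed.

End L2sq.

(** * Maps that preserve the measure of a set *)

Section preserving.
Context d (T : measurableType d) (R : realType).
Variables (mu : {measure set T -> \bar R}) (D : set T).

(** The maps of interest only send almost every point of [D] into [D].  A
    function on [D] is arbitrary outside [D], so its composition with such a map
    would not be measurable without control on the exceptional points; the last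
    field sends them all to one point. *)
Record preserves_measure (phi : T -> T) : Prop := {
  preserves_measurable : measurable_fun setT phi ;
  preserves_measureE : forall B, measurable B ->
    mu (D `&` phi @^-1` B) = mu (D `&` B) ;
  preserves_escape : exists c, forall x, D x -> D (phi x) \/ phi x = c }.

Hypothesis mD : measurable D.
Variable phi : T -> T.
Hypothesis pmphi : preserves_measure phi.

Let mphi := preserves_measurable pmphi.

Let measurable_preim (B : set T) : measurable B -> measurable (phi @^-1` B).
Proof. by move=> mB; rewrite -[X in measurable X]setTI; exact: mphi. Qed.

Lemma measurable_comp_preserving d' (T' : measurableType d') (h : T -> T') :
  measurable_fun D h -> measurable_fun D (h \o phi).
Proof.
move=> mh.
have -> : D = (D `&` phi @^-1` D) `|` (D `\` phi @^-1` D).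
  by rewrite setDE -setIUr setUCr setIT.
have mpD := measurable_preim mD.
apply/measurable_funU; [exact: measurableI|exact: measurableD|split].
  apply: (measurable_comp mD) => //; last exact: measurable_funTS.
  by move=> _ [x [Dx pDx] <-].
have [c cP] := preserves_escape pmphi.
apply: (@eq_measurable_fun _ _ _ _ _ (cst (h c))).
  move=> x /set_mem[Dx pDx] /=.
  by have [//|->] := cP x Dx.
exact: measurable_cst.
Qed.

Lemma preserving_escape_null : mu (D `\` phi @^-1` D) = 0%E.
Proof.
rewrite setDE preimage_setC (preserves_measureE pmphi); last exact: measurableC.
by rewrite setICr measure0.
Qed.

Lemma ae_preserving (P : T -> Prop) : {ae mu, forall x, D x -> P x} ->
  {ae mu, forall x, D x -> P (phi x)}.
Proof.
move=> [N [mN N0 PN]].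
exists ((D `\` phi @^-1` D) `|` (D `&` phi @^-1` N)); split.
- apply: measurableU; last exact/measurableI/measurable_preim.
  exact/measurableD/measurable_preim.
- rewrite null_set_setU//.
  + exact/measurableD/measurable_preim.
  + exact/measurableI/measurable_preim.
  + exact: preserving_escape_null.
  + rewrite (preserves_measureE pmphi)//; apply: (subset_measure0 _ _ _ N0) => //.
    exact: measurableI.
- move=> x /= /not_implyP[Dx nP].
  have [Dpx|Dpx] := pselect (D (phi x)); last by left.
  right; split=> //; apply: PN => /=; exact/not_implyP.
Qed.

(** Restricting [mu] to [D] turns the hypothesis into an equality between [mu]
    and an image measure on the subsets of [D], so that the change of variables
    for image measures applies. *)
Lemma ge0_integral_preserving (h : T -> \bar R) : measurable_fun D h ->
  (forall x, (0 <= h x)%E) ->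
  (\int[mu]_(x in D) h (phi x) = \int[mu]_(x in D) h x)%E.
Proof.
move=> mh h0; have mpD := measurable_preim mD.
have mDp : measurable (D `\` phi @^-1` D) by exact: measurableD.
rewrite (ge0_negligible_integral _ _ _ _ preserving_escape_null)//; first last.
  exact: (measurable_comp_preserving mh).
rewrite setDD.
have mhp : measurable_fun (phi @^-1` D) (h \o phi).
  apply: (measurable_comp mD) => //; last exact: measurable_funTS.
  by move=> _ [x pDx <-].
transitivity (\int[pushforward (mrestr mu mD) phi]_(x in D) h x)%E.
  rewrite (ge0_integral_pushforward mphi)//.
  have := @ge0_negligible_integral _ _ _ (mrestr mu mD) (phi @^-1` D)
    ((phi @^-1` D) `\` D) (h \o phi) _ mpD mhp.
  rewrite setDD => ->.
  - rewrite setIC; apply/esym/eq_measure_integral => A mA AD.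
    by rewrite /= /mrestr setIidl// => x /AD[].
  - exact: measurableD.
  - by move=> x _; exact: h0.
  - by rewrite /= /mrestr -setIA setICl setI0 measure0.
apply: eq_measure_integral => A mA AD; rewrite /= /pushforward /mrestr.
by rewrite setIC (preserves_measureE pmphi)// setIidr.
Qed.

Lemma integral_preserving (h : T -> \bar R) : measurable_fun D h ->
  (\int[mu]_(x in D) h (phi x) = \int[mu]_(x in D) h x)%E.
Proof.
move=> mh; rewrite integralE [RHS]integralE; congr (_ - _)%E.
- rewrite -(ge0_integral_preserving (measurable_funepos mh)); last first.
    by move=> x; exact: funepos_ge0.
  by apply: eq_integral => x _; rewrite !funeposE.
- rewrite -(ge0_integral_preserving (measurable_funeneg mh)); last first.
    by move=> x; exact: funeneg_ge0.
  by apply: eq_integral => x _; rewrite !funenegE.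
Qed.

Lemma cintegral_preserving (f : T -> R[i]) : cmeasurable D f ->
  cintegral mu D (f \o phi) = cintegral mu D f.
Proof.
move=> [f1 f2]; rewrite /cintegral; congr Complex; rewrite /Rintegral.
- by rewrite -(integral_preserving (h := fun x => (complex.Re (f x))%:E))//;
    exact/measurable_EFinP.
- by rewrite -(integral_preserving (h := fun x => (complex.Im (f x))%:E))//;
    exact/measurable_EFinP.
Qed.

Lemma cmeasurable_preserving (f : T -> R[i]) : cmeasurable D f ->
  cmeasurable D (f \o phi).
Proof.
move=> [f1 f2]; split.
- exact: (measurable_comp_preserving f1).
- exact: (measurable_comp_preserving f2).
Qed.

Lemma L2sq_preserving (f : T -> R[i]) : cmeasurable D f ->
  L2sq mu D (f \o phi) = L2sq mu D f.
Proof.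
move=> mf.
rewrite /L2sq -(ge0_integral_preserving (h := fun x => (sqnorm (f x))%:E))//.
- exact: measurable_EFin_sqnorm.
- by move=> x; rewrite lee_fin sqnorm_ge0.
Qed.

Lemma cLp2_preserving (f : T -> R[i]) : cLp mu 2%:E D f ->
  cLp mu 2%:E D (f \o phi).
Proof.
move=> /(cLp2P mu D)[mf f2]; apply/cLp2P.
by split; [exact: cmeasurable_preserving|rewrite L2sq_preserving].
Qed.

Lemma cLp1_preserving (f : T -> R[i]) : cLp mu 1%:E D f ->
  cLp mu 1%:E D (f \o phi).
Proof.
move=> -[mf]; rewrite cLnorm1E => f1.
split; first exact: cmeasurable_preserving.
rewrite cLnorm1E (ge0_integral_preserving (h := fun x => (normc (f x))%:E))//.
- exact/measurable_EFinP/measurable_normc.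
- by move=> x; rewrite lee_fin normc_ge0.
Qed.

End preserving.

(** * A density principle for L2 *)

Section density.
Context d (T : measurableType d) (R : realType).
Variables (mu : {measure set T -> \bar R}) (D : set T) (mD : measurable D).
Implicit Types (B : set T) (f g : T -> R[i]) (a : T -> R).

Definition creal a : T -> R[i] := fun x => Complex (a x) 0.

Definition cindic B : T -> R[i] := creal \1_B.

Lemma cmeasurable_real a : measurable_fun D a ->
  cmeasurable D (creal a).
Proof. by move=> ma; split => //=; exact: measurable_cst. Qed.

Lemma sqnorm_real (r : R) : sqnorm (Complex r 0) = r ^+ 2.
Proof. by rewrite /sqnorm/= expr0n addr0. Qed.

Lemma L2sq_cindic B : measurable B -> L2sq mu D (cindic B) = mu (B `&` D).
Proof.
move=> mB; rewrite /L2sq -integral_indic//.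
by apply: eq_integral => x _; rewrite sqnorm_real indicE; case: (_ \in _);
  rewrite ?expr1n ?expr0n.
Qed.

Lemma cLp2_cindic B : measurable B -> (mu (B `&` D) < +oo)%E ->
  cLp mu 2%:E D (cindic B).
Proof.
move=> mB muB; apply/cLp2P; rewrite L2sq_cindic//; split=> //.
by apply: cmeasurable_real; exact: measurable_indic.
Qed.

Lemma L2sq_le f g : cmeasurable D f -> cmeasurable D g ->
  (forall x, D x -> sqnorm (f x) <= sqnorm (g x)) ->
  (L2sq mu D f <= L2sq mu D g)%E.
Proof.
move=> mf mg fg; apply: ge0_le_integral => //.
- by move=> x _; rewrite lee_fin sqnorm_ge0.
- exact: measurable_EFin_sqnorm.
- exact: measurable_EFin_sqnorm.
Qed.

Lemma cLp2_le f g : cmeasurable D f -> cLp mu 2%:E D g ->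
  (forall x, D x -> sqnorm (f x) <= sqnorm (g x)) -> cLp mu 2%:E D f.
Proof.
move=> mf /cLp2P[mg g2] fg; apply/cLp2P; split=> //.
exact: le_lt_trans (L2sq_le mf mg fg) g2.
Qed.

Variable P : (T -> R[i]) -> Prop.
Hypothesis P_comb : forall (a : R[i]) f g,
  cLp mu 2%:E D f -> cLp mu 2%:E D g -> P f -> P g ->
  P (fun x => a * f x + g x).
Hypothesis P_closed : forall f, cLp mu 2%:E D f ->
  (forall e : R, 0 < e -> exists g, [/\ cLp mu 2%:E D g, P g &
    (L2sq mu D (fun x => f x - g x)%R <= e%:E)%E]) -> P f.
Hypothesis P_cindic : forall B, measurable B -> B `<=` D -> (mu B < +oo)%E ->
  P (cindic B).

Let P0 : P (fun=> 0).
Proof.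
rewrite (_ : (fun=> _) = cindic set0); last first.
  by apply/funext => x; rewrite /cindic /creal indic0.
by apply: P_cindic; rewrite ?measure0.
Qed.

Let P_step (I : Type) (s : seq I) (c : I -> R) (B : I -> set T) :
  (forall i, measurable (B i)) -> (forall i, B i `<=` D) ->
  (forall i, c i != 0 -> (mu (B i) < +oo)%E) ->
  let g x := Complex (\sum_(i <- s) c i * \1_(B i) x) 0 in
  cLp mu 2%:E D g /\ P g.
Proof.
move=> mB BD muB; elim: s => [|i s [IH1 IH2]] /=.
  under eq_fun do rewrite big_nil.
  by split; [exact: cLp2_0|exact: P0].
have [ci0|ci0] := eqVneq (c i) 0.
  by under eq_fun do rewrite big_cons ci0 mul0r add0r.
have E : (fun x => Complex (\sum_(i <- i :: s) c i * \1_(B i) x) 0) =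
    (fun x => Complex (c i) 0 * cindic (B i) x +
              Complex (\sum_(i <- s) c i * \1_(B i) x) 0).
  apply/funext => x; rewrite big_cons /cindic /creal; apply/eqP.
  by rewrite eq_complex/= !mulr0 !mul0r subr0 !addr0 !eqxx.
have Bi : cLp mu 2%:E D (cindic (B i)).
  by apply: cLp2_cindic => //; rewrite setIidl//; exact: muB.
rewrite E; split; first exact: cLp2_comb.
by apply: P_comb => //; apply: P_cindic => //; exact: muB.
Qed.

Import HBNNSimple.

(** A square integrable simple function is a combination of indicators of finite
   measure: only its level set for the value 0 may have infinite measure. *)
Let P_nnsfun (h : {nnsfun T >-> R}) :
  cLp mu 2%:E D (creal h) ->
  exists g, [/\ cLp mu 2%:E D g, P g & forall x, D x -> g x = creal h x].
Proof.
move=> hL; pose B y := h @^-1` [set y] `&` D.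
have mB y : measurable (B y) by exact: measurableI.
have BD y : B y `<=` D by move=> x [].
have muB y : y != 0 -> (mu (B y) < +oo)%E.
  move=> y0; have /(cLp2P mu D)[mh h2] := hL.
  (* Chebyshev's inequality at the level y *)
  have : ((y ^+ 2)%:E * mu (B y) <= L2sq mu D (creal h))%E.
    rewrite -integral_cst//.
    apply: (@le_trans _ _ (\int[mu]_(x in B y) (sqnorm (creal h x))%:E)%E).
      apply: ge0_le_integral => //.
      - by move=> x _; rewrite lee_fin sqr_ge0.
      - apply: measurable_funS (measurable_EFin_sqnorm mh) => //.
      - by move=> x [/= <- _]; rewrite lee_fin sqnorm_real.
    apply: ge0_subset_integral => //.
    - exact: measurable_EFin_sqnorm.
    - by move=> x _; rewrite lee_fin sqnorm_ge0.
  move=> /le_lt_trans/(_ h2).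
  have y2 : 0 < y ^+ 2 by rewrite exprn_even_gt0.
  by rewrite !ltey; apply: contraNN => /eqP ->; rewrite mulry gtr0_sg// mul1e.
have [gL gP] := P_step (finmap.enum_fset (fset_set (range h))) (c := id) mB BD muB.
exists (fun x => Complex (\sum_(y <- finmap.enum_fset (fset_set (range h))) y * \1_(B y) x) 0).
split=> // x Dx; congr Complex.
rewrite fimfunE fsbig_finite//=; apply: eq_bigr => y _; congr (_ * _).
by rewrite !indicE in_setI (mem_set Dx) andbT.
Qed.

(** Simple functions increasing to [a] converge in L2, with dominating function
   [a ^+ 2]. *)
Let P_ge0 a : (forall x, 0 <= a x) -> cLp mu 2%:E D (creal a) ->
  P (creal a).
Proof.
move=> a0 aL; have /(cLp2P mu D)[[/= ma _] a2] := aL.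
have mEa : measurable_fun D (EFin \o a) by exact/measurable_EFinP.
have Ea0 x : D x -> (0 <= (EFin \o a) x)%E by move=> _; rewrite lee_fin.
pose h n := nnsfun_approx mD mEa n.
have ha n x : D x -> h n x <= a x.
  by move=> Dx; rewrite -lee_fin /h nnsfun_approxE; exact: le_approx.
have mh n : measurable_fun D (h n) by exact: measurable_funTS.
have hL n : cLp mu 2%:E D (creal (h n)).
  apply: (cLp2_le _ aL); first exact: cmeasurable_real.
  by move=> x Dx; rewrite !sqnorm_real lerXn2r ?nnegrE ?fun_ge0// ha.
have cvg0 : (fun n => L2sq mu D (fun x => creal a x - creal (h n) x)%R)
    @ \oo --> 0%E.
  have msq : measurable_fun D (fun x => (a x ^+ 2)%:E).
    by apply/measurable_EFinP; exact: measurable_funX.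
  have [| | | | |_ _] := @dominated_convergence _ _ _ mu D mD
    (fun n x => ((a x - h n x) ^+ 2)%:E) (cst 0%E) (fun x => (a x ^+ 2)%:E).
  - move=> n; apply/measurable_EFinP/measurable_funX.
    exact: measurable_funB.
  - exact: measurable_cst.
  - apply: aeW => x Dx.
    have hx : h ^~ x @ \oo --> a x.
      have := cvg_nnsfun_approx mD mEa Ea0 Dx.
      by move/fine_cvgP => [].
    have hx0 : (fun n => a x - h n x) @ \oo --> 0.
      rewrite -(subrr (a x)); apply: cvgB => //; exact: cvg_cst.
    have hx2 : (fun n => (a x - h n x) ^+ 2) @ \oo --> 0.
      rewrite -(mulr0 (0 : R)); under eq_fun do rewrite expr2.
      exact: cvgM.
    by apply/fine_cvgP; split; [exact: nearW|].
  - apply/integrableP; split=> //.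
    apply: le_lt_trans a2; rewrite le_eqVlt; apply/orP; left; apply/eqP.
    apply: eq_integral => x _; rewrite sqnorm_real gee0_abs// lee_fin sqr_ge0//.
  - apply: aeW => x n Dx; rewrite gee0_abs ?lee_fin ?sqr_ge0//.
    rewrite lerXn2r ?nnegrE ?subr_ge0 ?ha// lerBlDr lerDl fun_ge0//.
  rewrite integral0 => h0; apply: cvg_trans h0; apply: near_eq_cvg.
  near=> n; apply: eq_integral => x _.
  by rewrite /sqnorm/= subrr expr0n addr0.
apply: P_closed => // e e0.
have [n hn] : exists n,
    (L2sq mu D (fun x => creal a x - creal (h n) x)%R <= e%:E)%E.
  have : \forall n \near \oo,
      (L2sq mu D (fun x => creal a x - creal (h n) x)%R < e%:E)%E.
    apply: (cvg0 [set y | (y < e%:E)%E]); apply: open_nbhs_nbhs; split; last by rewrite /= lte_fin.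
    exact: open_ereal_lt_ereal.
  by move=> [n _ hn]; exists n; apply/ltW/hn => /=.
have [g [gL Pg gh]] := P_nnsfun (hL n).
exists g; split=> //; apply: le_trans hn.
by rewrite (@eq_L2sq _ _ _ _ _ _ (fun x => creal a x - creal (h n) x)%R)//
  => x Dx; rewrite gh.
Unshelve. all: by end_near. Qed.

(** Induction principle: simple functions are dense, and linearity reduces a
    complex function to the positive and negative parts of its real and
    imaginary parts.  *)
Lemma cLp2_ind f : cLp mu 2%:E D f -> P f.
Proof.
move=> fL; have [[mRe mIm] _] := fL.
pose pos (a : T -> R) x := Num.max (a x) 0.
have creal_pos a : measurable_fun D a ->
    (forall x, a x ^+ 2 <= sqnorm (f x)) ->
    cLp mu 2%:E D (creal (pos a)) /\ P (creal (pos a)).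
  move=> ma af; have pos0 x : 0 <= pos a x by rewrite le_max lexx orbT.
  have aL : cLp mu 2%:E D (creal (pos a)).
    apply: (cLp2_le _ fL).
      apply: cmeasurable_real; exact: measurable_maxr.
    move=> x _; rewrite sqnorm_real; apply: le_trans (af x).
    by rewrite /pos; case: (leP (a x) 0) => _ //; rewrite expr0n/= sqr_ge0.
  by split=> //; exact: P_ge0.
have ReL x : complex.Re (f x) ^+ 2 <= sqnorm (f x) by rewrite lerDl sqr_ge0.
have ImL x : complex.Im (f x) ^+ 2 <= sqnorm (f x) by rewrite lerDr sqr_ge0.
have [a1L Pa1] := creal_pos _ mRe ReL.
have [b1L Pb1] := creal_pos _ mIm ImL.
have [||a2L Pa2] := creal_pos (fun x => - complex.Re (f x)).
- exact: measurableT_comp.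
- by move=> x; rewrite sqrrN.
have [||b2L Pb2] := creal_pos (fun x => - complex.Im (f x)).
- exact: measurableT_comp.
- by move=> x; rewrite sqrrN.
have L0 := cLp2_0 mu D.
have step (z : R[i]) g h : cLp mu 2%:E D g /\ P g -> cLp mu 2%:E D h /\ P h ->
    cLp mu 2%:E D (fun x => z * g x + h x) /\ P (fun x => z * g x + h x).
  by move=> [gL Pg] [hL Ph]; split; [exact: cLp2_comb|exact: P_comb].
have := step 1 _ _ (conj a1L Pa1) (step (-1) _ _ (conj a2L Pa2)
  (step (Complex 0 1) _ _ (conj b1L Pb1) (step (Complex 0 (-1)) _ _
    (conj b2L Pb2) (conj L0 P0)))).
case=> _; congr P; apply/funext => x.
have posN (r : R) : Num.max r 0 - Num.max (- r) 0 = r.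
  by case: (leP r 0) => r0; case: (leP (- r) 0) => r1; lra.
rewrite /creal /pos; apply/eqP; rewrite eq_complex/=.
apply/andP; split; apply/eqP; rewrite -[RHS]posN; ring.
Qed.
End density.
Arguments cindic {d T R} B.

(** * Translation invariance of Lebesgue measure *)

Section lebesgue_translation.
Context (R : realType).

Lemma lebesgue_measure_translate (t : R) (A : set R) : measurable A ->
  lebesgue_measure ((fun x => x + t) @^-1` A) = lebesgue_measure A.
Proof.
move=> mA.
have mt : measurable_fun setT ((fun x => x + t) : measurableTypeR R -> measurableTypeR R).
  exact: measurable_funD.
pose nu : {measure set (measurableTypeR R) -> \bar R} :=
  Measure.clone _ _ _ (pushforward lebesgue_measure
    ((fun x => x + t) : measurableTypeR R -> measurableTypeR R))
  (measure_function_pushforward__canonical__measure_function_Measure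
       lebesgue_measure mt).
apply/esym; apply: (@lebesgue_measure_unique R nu) => //= _ [[a b]] _ <-.
rewrite /= /nu/= /pushforward.
rewrite (_ : _ @^-1` _ = `]a - t, b - t]%classic); last first.
  apply/seteqP; split=> x /=; rewrite !in_itv/= => /andP[xa xb].
    by rewrite ltrBlDr xa lerBrDr.
  by rewrite -ltrBlDr xa -lerBrDr.
rewrite !lebesgue_measure_itv/= !lte_fin ltrD2r; case: ifPn => // _.
by rewrite -!EFinD; congr EFin; ring.
Qed.

Lemma measurable_translate_cV n (t : 'cV[R]_n) :
  measurable_fun setT (fun x : 'cV[R]_n => x + t).
Proof.
apply: measurable_fun_cV => i; under eq_fun do rewrite mxE.
apply: measurable_funD => //; exact: measurable_coord.
Qed.

Lemma translateE n (A : set 'cV[R]_n) t : translate A t = (fun x => x - t) @^-1` A.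
Proof.
apply/seteqP; split=> [_ [x Ax <-]|x Ax] /=; first by rewrite addrK.
by exists (x - t) => //; rewrite subrK.
Qed.

Lemma open_shift n (A : set 'cV[R]_n) t : open A -> open ((fun x => x + t) @^-1` A).
Proof.
move=> oA; apply: open_comp; last exact: oA.
move=> x _; apply: (@cvgD _ _ _ (nbhs x) _ id (cst t) x t).
  exact: cvg_id.
exact: cvg_cst.
Qed.

Lemma measurable_shift n (A : set 'cV[R]_n) t :
  measurable A -> measurable ((fun x => x + t) @^-1` A).
Proof.
by move=> mA; rewrite -[X in measurable X]setTI; exact: measurable_translate_cV.
Qed.

(** The translate of a product measure takes the same values on rectangles, by
    invariance in each factor; uniqueness of the product measure concludes. *)
Lemma lebesgue_cV_translate n (t : 'cV[R]_n) (A : set 'cV[R]_n) :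
  measurable A -> lebesgue_cV R n ((fun x => x + t) @^-1` A) = lebesgue_cV R n A.
Proof.
elim: n t A => [|n IHn] t A mA.
  congr (lebesgue_cV R 0 _); apply/seteqP.
  by split=> x /=; rewrite (flatmx0 (x + t)) (flatmx0 x).
pose sh (p : measurableTypeR R * 'cV[R]_n) : measurableTypeR R * 'cV[R]_n :=
  (p.1 + (uncons_cV t).1, p.2 + (uncons_cV t).2).
have msh : measurable_fun setT sh.
  apply: measurable_fun_pair.
    exact: measurable_funD.
  by apply: (measurableT_comp (measurable_translate_cV _)).
pose prod := (lebesgue_measure \x lebesgue_cV R n)%E.
pose nu : {measure set (measurableTypeR R * 'cV[R]_n) -> \bar R} :=
  Measure.clone _ _ _ (pushforward prod sh)
  (measure_function_pushforward__canonical__measure_function_Measure prod msh).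
have nuE : forall X, measurable X -> prod X = nu X.
  apply: product_measure_unique => B C mB mC.
  rewrite /nu/= /pushforward.
  have -> : sh @^-1` (B `*` C) = ((fun x => x + (uncons_cV t).1) @^-1` B) `*`
      ((fun x => x + (uncons_cV t).2) @^-1` C) by [].
  rewrite [LHS]product_measure1E.
  - congr (_ * _)%E; [exact: lebesgue_measure_translate|exact: IHn].
  - rewrite -[X in measurable X]setTI; apply: measurable_funD => //.
  - by rewrite -[X in measurable X]setTI; exact: measurable_translate_cV.
have mcA : measurable (@cons_cV R n @^-1` A).
  by rewrite -[X in measurable X]setTI; exact: measurable_cons_cV.
rewrite /= /lebesgue_cons /pushforward [RHS](nuE _ mcA) /nu/= /pushforward.
congr (prod _); apply/funext => p /=; congr A.
apply/matrixP => i j; rewrite !ord1 [LHS]mxE.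
by case: (unliftP ord0 i) => [k|] ->; rewrite ?cons_cV0 ?cons_cVS //= !mxE.
Qed.

Lemma lebesgue_cV_ball n (x : 'cV[R]_n) (e : R) : 0 < e ->
  lebesgue_cV R n (ball x e) = ((e *+ 2) ^+ n)%:E.
Proof.
move=> e0.
have -> : ball x e = [set y | forall i, ball (x i 0) e (y i 0)].
  apply/seteqP; split=> y /=.
    by move=> [_ xy] i; exact: xy.
  by move=> xy; split=> // i j; rewrite (ord1 j); exact: xy.
rewrite (@lebesgue_cV_box _ _ (fun i => ball (x i 0) e : set R)).
  under eq_bigr do rewrite lebesgue_measure_ball ?ltW//.
  by rewrite prodEFin prodr_const card_ord.
by move=> i; exact: measurable_ball.
Qed.

(** This is what turns tilings up to null sets into honest disjointness. *)
Lemma open_lebesgue_cV_eq0 n (U : set 'cV[R]_n) :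
  open U -> lebesgue_cV R n U = 0%E -> U = set0.
Proof.
move=> oU U0; apply/eqP/negPn/negP => /set0P[x Ux].
have /nbhs_ballP[e /= e0 eU] : nbhs x U by exact: open_nbhs_nbhs.
have : (lebesgue_cV R n (ball x e) <= lebesgue_cV R n U)%E.
  apply: le_measure => //; rewrite inE; apply: open_measurable_cV => //.
  exact: ball_open.
rewrite U0 lebesgue_cV_ball// lee_fin leNgt exprn_gt0//.
by rewrite mulrn_wgt0.
Qed.

End lebesgue_translation.

(** * Countable unions indexed by an arbitrary countable set *)

Section countable_families.
Context d (X : measurableType d) (R : realType) (I : Type) (A : set I).
Hypothesis cA : countable A.
Implicit Types E F : I -> set X.

(** An injection [f] into nat re-indexes the family by nat; the layers outside
   the range of [f] are empty. *)
Let layer (f : I -> nat) E n := \bigcup_(i in [set i | A i /\ f i = n]) E i.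

Let layer_at f E i : {in A &, injective f} -> A i -> layer f E (f i) = E i.
Proof.
move=> finj Ai; apply/seteqP; split=> [x [j [Aj fji] Ex]|x Ex].
  by rewrite -(finj j i)// inE.
by exists i.
Qed.

Let layer_cover f E : \bigcup_n layer f E n = \bigcup_(i in A) E i.
Proof.
apply/seteqP; split=> [x [n _ [i [Ai _] Ex]]|x [i Ai Ex]]; first by exists i.
by exists (f i) => //; exists i.
Qed.

Let layer_or f n : (exists2 i, A i & f i = n) \/ (forall E, layer f E n = set0).
Proof.
have [[i Ai fi]|nA] := pselect (exists2 i, A i & f i = n).
  by left; exists i.
right=> E; apply/eqP/negPn/negP => /set0P[x [i [Ai fi] _]].
by apply: nA; exists i.
Qed.

Let measurable_layer f E n : {in A &, injective f} ->
  (forall i, A i -> measurable (E i)) -> measurable (layer f E n).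
Proof.
move=> finj mE; have [[i Ai <-]|->//] := layer_or f n.
by rewrite layer_at//; exact: mE.
Qed.

Let trivIset_layer f E : trivIset A E -> trivIset setT (layer f E).
Proof.
move=> tE i j _ _ [x [[k [Ak fk] Ekx] [l [Al fl] Elx]]].
by rewrite -fk -fl (tE k l)//; exists x.
Qed.

Lemma countable_bigcup_measurable E : (forall i, A i -> measurable (E i)) ->
  measurable (\bigcup_(i in A) E i).
Proof.
move=> mE; have /countable_injP[f finj] := cA.
rewrite -(layer_cover f); apply: bigcupT_measurable => n.
exact: measurable_layer.
Qed.

(** Two sets cut into corresponding pieces of equal measure have equal measure.
    Sigma-additivity concerns sequences, whence the layers. *)
Lemma measure_countable_bigcup_eq (mu : {measure set X -> \bar R}) E F :
  (forall i, A i -> measurable (E i)) -> (forall i, A i -> measurable (F i)) ->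
  trivIset A E -> trivIset A F -> (forall i, A i -> mu (E i) = mu (F i)) ->
  mu (\bigcup_(i in A) E i) = mu (\bigcup_(i in A) F i).
Proof.
move=> mE mF tE tF EF; have /countable_injP[f finj] := cA.
rewrite -!(layer_cover f) !measure_bigcup; first last.
- exact: trivIset_layer.
- by move=> n _; exact: measurable_layer.
- exact: trivIset_layer.
- by move=> n _; exact: measurable_layer.
apply: eq_eseriesr => n _; have [[i Ai <-]|E0] := layer_or f n.
  by rewrite !layer_at// EF.
by rewrite !E0.
Qed.

End countable_families.

(** * The decomposition of space by a tiling *)

Section tiling.
Context (R : realType) (d : nat) (Omega T : set 'cV[R]_d).
Hypothesis openOmega : open Omega.
Hypothesis subgroupT : discrete_subgroup T.
Hypothesis tilesOmega : tiles Omega T.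
Local Notation leb := (lebesgue_cV R d).
Local Notation V := 'cV[R]_d.
Local Notation tile := (tile_point Omega T).

Lemma subgroup0 : T 0. Proof. exact: discrete_subgroup0 subgroupT. Qed.

Lemma subgroupB x y : T x -> T y -> T (x - y).
Proof. exact: (discrete_subgroupB subgroupT). Qed.

Lemma subgroupN x : T x -> T (- x).
Proof. by move=> Tx; rewrite -sub0r; apply: subgroupB => //; exact: subgroup0. Qed.

Lemma subgroupD x y : T x -> T y -> T (x + y).
Proof. by move=> Tx Ty; rewrite -(opprK y); apply/subgroupB/subgroupN. Qed.

Lemma open_translate t : open (translate Omega t).
Proof. by rewrite translateE; exact: open_shift. Qed.

(** The overlap of two translates of an open set is open, so being null it is
    empty: uniqueness holds everywhere, not just almost everywhere. *)
Lemma tiles_unique y z g h : Omega y -> Omega z -> T g -> T h ->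
  y + g = z + h -> y = z /\ g = h.
Proof.
move=> Oy Oz Tg Th yz.
suff gh : g = h by split=> //; move: yz; rewrite gh; exact: addIr.
apply: contrapT => gh.
have oI : open (translate Omega g `&` translate Omega h).
  by apply: openI; exact: open_translate.
have /(open_lebesgue_cV_eq0 oI) I0 :
    leb (translate Omega g `&` translate Omega h) = 0%E.
  apply: measure_negligible; first exact: open_measurable_cV.
  exact: tilesOmega.1.
suff : (set0 : set V) (y + g) by [].
by rewrite -I0; split; [exists y|exists z].
Qed.

Definition tiled : set V := \bigcup_(t in T) translate Omega t.

Lemma open_tiled : open tiled.
Proof. by apply: bigcup_open => t _; exact: open_translate. Qed.

Lemma measurable_tiled : measurable tiled.
Proof. by apply: open_measurable_cV; exact: open_tiled. Qed.

Lemma untiled_null : leb (~` tiled) = 0%E.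
Proof.
apply: measure_negligible; last exact: tilesOmega.2.
by apply: measurableC; exact: measurable_tiled.
Qed.

Lemma tile_pointD y g : Omega y -> T g -> tile (y + g) = y.
Proof.
move=> Oy Tg; apply: xget_unique => /=; first by rewrite addrAC subrr add0r.
move=> z [Oz Tz]; suff [] : z = y /\ y + g - z = g by [].
by apply: tiles_unique => //; rewrite addrC subrK.
Qed.

Lemma tile_point_id y : Omega y -> tile y = y.
Proof. by move=> Oy; rewrite -{1}(addr0 y) tile_pointD//; exact: subgroup0. Qed.

Lemma tile_pointP x : tiled x -> Omega (tile x) /\ T (x - tile x).
Proof.
by move=> [g Tg [y Oy <-]]; rewrite tile_pointD// addrAC subrr add0r.
Qed.

Lemma tile_point_untiled x : ~ tiled x -> tile x = 0.
Proof.
move=> nx; apply: xgetPN => y [Oy Ty]; apply: nx.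
by exists (x - y) => //; exists y => //; rewrite addrC subrK.
Qed.

(** The two points have the same candidates for their representative in
    [Omega], so this holds even where the default value is taken. *)
Lemma tile_point_periodic x g : T g -> tile (x + g) = tile x.
Proof.
move=> Tg; rewrite /tile_point; congr xget; apply/seteqP.
split=> y /= [Oy Ty]; split=> //.
  by rewrite (_ : x - y = x + g - y - g); [exact: subgroupB|by rewrite (addrAC x g) addrK].
by rewrite addrAC; exact: subgroupD.
Qed.

Lemma Omega_neq0 : Omega !=set0.
Proof.
apply/set0P/eqP => O0; have : (0 < leb (ball (0%R : V) 1%R))%E.
  by rewrite lebesgue_cV_ball// lte_fin exprn_gt0.
have <- : leb (~` tiled) = 0%E by exact: untiled_null.
rewrite ltNge => /negP; apply.
apply: le_measure; rewrite ?inE.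
- by apply: open_measurable_cV; exact: ball_open.
- by apply: measurableC; exact: measurable_tiled.
- by move=> x _ [t _ []]; rewrite O0.
Qed.

(** Each translate of [Omega] contains a rational point, which determines it. *)
Lemma countable_translations : countable T.
Proof.
pose q (r : 'cV[rat]_d) : V := map_mx ratr r.
pose gam (r : 'cV[rat]_d) := xget 0 [set g | T g /\ translate Omega g (q r)].
suff TS : T `<=` range gam.
  apply: sub_countable (subset_card_le TS) _.
  exact: sub_countable (card_image_le _ _) (countableP _).
move=> g Tg; have [y Oy] := Omega_neq0.
have /nbhs_ballP[e /= e0 eU] : nbhs (y + g) (translate Omega g).
  by apply: open_nbhs_nbhs; split; [exact: open_translate|exists y].
have /choice[r rP] (i : 'I_d) : exists r : rat, `|(y + g) i 0 - ratr r| < e.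
  have [|r] := @rat_in_itvoo R ((y + g) i 0 - e) ((y + g) i 0 + e).
    by rewrite ltrD2l gtrN.
  rewrite in_itv/= => /andP[q1 q2]; exists r.
  by rewrite ltr_distlC q1 q2.
exists (\col_i r i) => //; apply: xget_unique.
  split=> //; apply: eU; split=> // i j; rewrite ord1 !mxE.
  by have := rP i; rewrite mxE.
move=> h [Th [z Oz zq]].
have [y' Oy' yq] : translate Omega g (q (\col_i r i)).
  apply: eU; split=> // i j; rewrite ord1 !mxE.
  by have := rP i; rewrite mxE.
by have [] := tiles_unique Oz Oy' Th Tg (etrans zq (esym yq)).
Qed.

Lemma tile_point_preimage (B : set V) : tile @^-1` B =
  (\bigcup_(g in T) translate (Omega `&` B) g) `|`
  (~` tiled `&` [set _ | B 0]).
Proof.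
apply/seteqP; split=> [x /= Bx|x [[g Tg [y [Oy By] <-]]|[nx B0]]] /=.
- have [tx|nx] := pselect (tiled x); last first.
    by right; split=> //=; rewrite -(tile_point_untiled nx).
  have [Ox Tx] := tile_pointP tx; left; exists (x - tile x) => //.
  by exists (tile x) => //; rewrite addrC subrK.
- by rewrite tile_pointD.
- by rewrite tile_point_untiled.
Qed.

Lemma measurable_tile_point : measurable_fun setT tile.
Proof.
move=> _ B mB; rewrite setTI tile_point_preimage; apply: measurableU.
  apply: (countable_bigcup_measurable countable_translations) => g _.
  rewrite translateE; apply: measurable_shift; apply: measurableI => //.
  exact: open_measurable_cV.
have [B0|B0] := pselect (B 0).
  rewrite (_ : [set _ | _] = setT); last by apply/seteqP; split.
  by rewrite setIT; apply: measurableC; exact: measurable_tiled.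
by rewrite (_ : [set _ | _] = set0) ?setI0//; apply/seteqP; split.
Qed.

Definition tile_shift_map t : V -> V := fun x => tile (x + t).

Lemma measurable_tile_shift_map t : measurable_fun setT (tile_shift_map t).
Proof.
exact: (measurableT_comp measurable_tile_point (measurable_translate_cV t)).
Qed.

Lemma untiled_shift_null t : leb ((fun x => x + t) @^-1` (~` tiled)) = 0%E.
Proof.
rewrite lebesgue_cV_translate; first exact: untiled_null.
by apply: measurableC; exact: measurable_tiled.
Qed.

Lemma ae_tiled_shift t : {ae leb, forall x, tiled (x + t)}.
Proof.
exists ((fun x => x + t) @^-1` (~` tiled)); split=> //.
- by apply: measurable_shift; apply: measurableC; exact: measurable_tiled.
- exact: untiled_shift_null.
Qed.

(** Up to null sets, [Omega `&` phi_t^-1 B] is the disjoint union of the sets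
    [E g] on which [phi_t] is the translation by [t - g], and [Omega `&` B] that
    of their images [F g].  The [F g] cover [Omega `&` B] because a point
    [y - t] is tiled by [- g] for some [g]. *)
Lemma measure_tile_shift_map t (B : set V) : measurable B ->
  leb (Omega `&` tile_shift_map t @^-1` B) = leb (Omega `&` B).
Proof.
move=> mB; have mO : measurable Omega by exact: open_measurable_cV.
have mOB : measurable (Omega `&` B) by exact: measurableI.
have mpre : measurable (tile_shift_map t @^-1` B).
  by rewrite -[X in measurable X]setTI; exact: measurable_tile_shift_map.
pose N s := (fun x : V => x + s) @^-1` (~` tiled).
have mN s : measurable (N s).
  by apply: measurable_shift; apply: measurableC; exact: measurable_tiled.
have dropN (A : set V) s : measurable A -> leb A = leb (A `\` N s).
  move=> mA; rewrite (measureDI leb mA (mN s)) -[RHS]adde0; congr (_ + _)%E.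
  apply: (subset_measure0 _ _ _ (untiled_shift_null s)).
  - exact: measurableI.
  - exact: mN.
  - exact: subIsetr.
rewrite (dropN _ t); last exact: measurableI.
rewrite (dropN (Omega `&` B) (- t))//.
pose E g := Omega `&` (fun x => x + (t - g)) @^-1` (Omega `&` B).
pose F g := (Omega `&` B) `&` (fun x => x + (g - t)) @^-1` Omega.
have -> : (Omega `&` tile_shift_map t @^-1` B) `\` N t = \bigcup_(g in T) E g.
  apply/seteqP; split=> [x [[Ox Bx] /contrapT tx]|x [g Tg [Ox [Oy By]]]].
    have [Otx Ttx] := tile_pointP tx; exists (x + t - tile (x + t)) => //.
    split=> //=; rewrite (_ : x + _ = tile (x + t)) ?subrK//.
    by rewrite addrA subKr.
  have tE : x + t = x + (t - g) + g by rewrite addrA subrK.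
  split; last by apply; rewrite tE; exists g => //; exists (x + (t - g)).
  by split=> //=; rewrite /tile_shift_map tE tile_pointD.
have -> : (Omega `&` B) `\` N (- t) = \bigcup_(g in T) F g.
  apply/seteqP; split=> [y [[Oy By] /contrapT ty]|y [g Tg [[Oy By] Oz]]].
    have [Oty Tty] := tile_pointP ty.
    exists (tile (y - t) - (y - t)); first by rewrite -opprB; exact: subgroupN.
    split=> //=; rewrite (_ : y + (_ - t) = tile (y - t))//.
    by rewrite addrA addrAC addrC subrK.
  split=> //; apply; exists (- g); first exact: subgroupN.
  by exists (y + (g - t)) => //; rewrite -addrA addrAC subrr add0r.
apply: (measure_countable_bigcup_eq countable_translations).
- by move=> g _; apply: measurableI => //; exact: measurable_shift.
- by move=> g _; apply: measurableI => //; exact: measurable_shift.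
- move=> g h Tg Th [x [[Ox [Og _]] [_ [Oh _]]]].
  suff [] : x + (t - g) = x + (t - h) /\ g = h by [].
  by apply: tiles_unique => //; rewrite !addrA !subrK.
- move=> g h Tg Th [y [[_ Og] [_ Oh]]]; apply: oppr_inj.
  suff [] : y + (g - t) = y + (h - t) /\ - g = - h by [].
  apply: tiles_unique => //; try exact: subgroupN.
  by rewrite !addrA !(addrAC _ _ (- t)) !addrK.
- move=> g Tg; rewrite -[RHS](lebesgue_cV_translate (t - g)); last first.
    by apply: measurableI => //; exact: measurable_shift.
  congr (leb _); apply/seteqP; split=> x /=.
    move=> [Ox OBx]; split=> //=.
    by rewrite -(opprB t g) addrK.
  by rewrite /F /E /= -(opprB t g) addrK => -[].
Qed.

Lemma preserves_measure_tile_shift t :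
  preserves_measure leb Omega (tile_shift_map t).
Proof.
split.
- exact: measurable_tile_shift_map.
- exact: measure_tile_shift_map.
- exists 0 => x _; have [tx|nx] := pselect (tiled (x + t)).
    by left; exact: (tile_pointP tx).1.
  by right; exact: tile_point_untiled.
Qed.

End tiling.

(** * The unitary group of local translations *)

Section translation_group.
Context (R : realType) (d : nat) (Omega T : set 'cV[R]_d).
Hypothesis openOmega : open Omega.
Hypothesis subgroupT : discrete_subgroup T.
Hypothesis tilesOmega : tiles Omega T.
Local Notation leb := (lebesgue_cV R d).
Local Notation V := 'cV[R]_d.
Local Notation tile := (tile_point Omega T).
Local Notation U := (tile_translation Omega T).
Local Notation phi := (tile_shift_map Omega T).
Implicit Types (f g : V -> R[i]) (t s : V).

Let mOmega : measurable Omega. Proof. exact: open_measurable_cV. Qed.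

Let pphi t : preserves_measure leb Omega (phi t).
Proof. exact: preserves_measure_tile_shift. Qed.

Let tile_id y : Omega y -> tile y = y.
Proof. exact: tile_point_id. Qed.

(** Moving [x] to its representative changes it by an element of [T], which the
    next representative does not see: this is the group law. *)
Lemma tile_pointDr x t : tiled Omega T x -> tile (tile x + t) = tile (x + t).
Proof.
move=> tx; have [_ Tx] := tile_pointP openOmega tilesOmega tx.
rewrite -(tile_point_periodic Omega subgroupT (tile x + t) Tx).
by rewrite addrAC (addrC (tile x)) subrK.
Qed.

Lemma tile_translationD s t f :
  {ae leb, forall x, U s (U t f) x = U (s + t) f x}.
Proof.
have := ae_tiled_shift openOmega tilesOmega s.
apply: filterS => x tx.
by rewrite /tile_translation tile_pointDr// addrA.
Qed.

Lemma tile_translation0 f x : Omega x -> U 0 f x = f x.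
Proof. by move=> Ox; rewrite /tile_translation addr0 tile_id. Qed.

Lemma unitary_tile_translation t : unitary leb Omega (U t).
Proof.
split.
- split.
  + by move=> f fL; exact: (cLp2_preserving mOmega (pphi t)).
  + move=> f g _ _ fg; exact: (ae_preserving mOmega (pphi t) fg).
  + by move=> a f g _ _; exact: aeW.
- move=> f g [mf _] [mg _]; rewrite /L2inner.
  apply: (cintegral_preserving mOmega (pphi t)
    (f := fun x => f x * conjc (g x))).
  by apply: cmeasurableM => //; exact: cmeasurable_conjc.
- move=> g gL; exists (U (- t) g); first exact: (cLp2_preserving mOmega (pphi (- t))).
  apply: filterS (tile_translationD t (- t) g) => x -> Ox.
  by rewrite subrr tile_translation0.
Qed.

Lemma tile_translation_local t (A : set V) f x : A `<=` Omega ->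
  translate A t `<=` Omega -> A x -> U t f x = f (x + t).
Proof.
move=> AO AtO Ax; rewrite /tile_translation tile_id//.
by apply: AtO; exists x.
Qed.

Lemma tile_translation_measurable t f : cmeasurable Omega f ->
  cmeasurable Omega (U t f).
Proof. exact: (cmeasurable_preserving mOmega (pphi t)). Qed.

Lemma L2sq_tile_translation t f : cmeasurable Omega f ->
  L2sq leb Omega (U t f) = L2sq leb Omega f.
Proof. exact: (L2sq_preserving mOmega (pphi t)). Qed.

(** Continuity of the orbit of [f] at time 0; by the group law and unitarity it
    gives continuity at every time. *)
Definition L2_continuous_at0 f := forall e : R, 0 < e ->
  \forall t \near (0 : V),
    (L2sq leb Omega (fun x => U t f x - f x)%R <= e%:E)%E.

Lemma L2_continuous_at0_comb (a : R[i]) f g :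
  cLp leb 2%:E Omega f -> cLp leb 2%:E Omega g ->
  L2_continuous_at0 f -> L2_continuous_at0 g ->
  L2_continuous_at0 (fun x => a * f x + g x).
Proof.
move=> [mf _] [mg _] Pf Pg e e0.
pose e' := e / (2 * sqnorm a + 2).
have a0 : 0 < 2 * sqnorm a + 2 by rewrite ltr_wpDl// mulr_ge0// sqnorm_ge0.
have e'0 : 0 < e' by rewrite divr_gt0.
near=> t.
have mUf := cmeasurableB (tile_translation_measurable t mf) mf.
have mUg := cmeasurableB (tile_translation_measurable t mg) mg.
rewrite (@eq_L2sq _ _ _ _ _ _
    (fun x => a * (U t f x - f x) + (U t g x - g x))%R); last first.
  by move=> x _; rewrite /tile_translation mulrBr opprD addrACA.
have maUf := cmeasurableM (cmeasurable_cst Omega a) mUf.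
apply: le_trans (L2sqD leb mOmega maUf mUg) _.
rewrite L2sqZ//.
have -> : e = 2 * (sqnorm a * e') + 2 * e'.
  by rewrite mulrA -mulrDl /e' mulrC divfK// gt_eqF.
rewrite [leRHS]EFinD !EFinM; apply: leeD; rewrite lee_pmul2l//.
- rewrite lee_wpmul2l ?lee_fin ?sqnorm_ge0//; by near: t; exact: Pf.
- by near: t; exact: Pg.
Unshelve. all: by end_near. Qed.

(** If [g] is close to [f], then [U t f - f] differs from [U t g - g] by
    [U t (f - g) - (f - g)], which is small uniformly in [t] because [U t] is
    isometric. *)
Lemma L2_continuous_at0_closed f : cLp leb 2%:E Omega f ->
  (forall e : R, 0 < e -> exists g, [/\ cLp leb 2%:E Omega g,
    L2_continuous_at0 g & (L2sq leb Omega (fun x => f x - g x)%R <= e%:E)%E]) ->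
  L2_continuous_at0 f.
Proof.
move=> [mf _] fg e e0.
(* Two uses of the factor 2 and the isometry give 2 * 4 * (e / 16) + 2 * (e / 4). *)
have e16 : 0 < e / 16 by rewrite divr_gt0.
have e4 : 0 < e / 4 by rewrite divr_gt0.
have [g [[mg _] Pg fge]] := fg _ e16.
have mh := cmeasurableB mf mg.
near=> t.
have mUh := tile_translation_measurable t mh.
have mUhh := cmeasurableB mUh mh.
have mUg := cmeasurableB (tile_translation_measurable t mg) mg.
rewrite (@eq_L2sq _ _ _ _ _ _
    (fun x => (U t (fun x => f x - g x) x - (f x - g x)) +
              (U t g x - g x))%R); last first.
  by move=> x _; rewrite /tile_translation; ring.
apply: le_trans (L2sqD leb mOmega mUhh mUg) _.
have -> : e = 2 * (4 * (e / 16)) + 2 * (e / 4) by field.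
rewrite [leRHS]EFinD !EFinM; apply: leeD; rewrite lee_pmul2l//; last first.
  by near: t; exact: Pg.
apply: (@le_trans _ _ (4%:E * L2sq leb Omega (fun x => f x - g x)%R)%E); last first.
  by rewrite lee_pmul2l.
have mNh := cmeasurableN mh.
apply: le_trans (L2sqD leb mOmega mUh mNh) _.
rewrite L2sq_tile_translation//.
rewrite (_ : L2sq leb Omega (fun x => - (f x - g x))%R =
  L2sq leb Omega (fun x => f x - g x)%R); last first.
  by apply: eq_integral => x _; rewrite sqnormN.
rewrite -ge0_muleDl ?lee_fin// -EFinD.
by rewrite lee_wpmul2r ?L2sq_ge0// lee_fin; lra.
Unshelve. all: by end_near. Qed.

(** The points of [A] at distance at least [r] from the complement of [A]: they
   stay in [A] under translations shorter than [r]. *)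
Let core (A : set V) (r : R) : set V := A `\` \bigcup_(y in ~` A) ball y r.

Let measurable_core A r : open A -> measurable (core A r).
Proof.
move=> oA; apply: measurableD; first exact: open_measurable_cV.
by apply: open_measurable_cV; apply: bigcup_open => y _; exact: ball_open.
Qed.

Let open_core_exhausts (A : set V) (e : R) : open A -> (leb A < +oo)%E -> 0 < e ->
  exists2 r, 0 < r & (leb (A `\` core A r) <= e%:E)%E.
Proof.
move=> oA Aoo e0.
pose F n := A `\` core A n.+1%:R^-1.
have mA : measurable A by exact: open_measurable_cV.
have mF n : measurable (F n) by apply: measurableD => //; exact: measurable_core.
have r0 n : 0 < n.+1%:R^-1 :> R by rewrite invr_gt0.
have niF : nonincreasing_seq F.
  move=> m n mn; apply/subsetPset => x [Ax nx]; split=> //.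
  move=> [_ nb]; apply: nx; split=> // -[y nAy yx]; apply: nb; exists y => //.
  apply: le_ball yx.
  by rewrite lef_pV2 ?posrE// ler_nat ltnS.
have F0 : \bigcap_n F n = set0.
  apply/eqP/negPn/negP => /set0P[x Fx].
  have [Ax _] := Fx 0%N I.
  have /nbhs_ballP[r /= rpos rA] : nbhs x A by exact: open_nbhs_nbhs.
  have [n] := ltr_add_invr rpos; rewrite add0r => nr.
  have [_] := Fx n I; apply; split=> // -[y nAy yx]; apply: nAy; apply: rA.
  by apply/ball_sym/le_ball/yx/ltW.
have : leb \o F @ \oo --> 0%E.
  rewrite -(measure0 leb) -F0; apply: nonincreasing_cvg_mu => //.
  - by apply: le_lt_trans Aoo; apply: le_measure; rewrite ?inE//; exact: subDsetl.
  - by rewrite F0.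
move=> /(_ [set y | (y < e%:E)%E]) [|n _ hn].
  apply: open_nbhs_nbhs; split; first exact: open_ereal_lt_ereal.
  by rewrite /= lte_fin.
by exists n.+1%:R^-1 => //; apply/ltW/(hn n) => /=.
Qed.

(** [X] is the preimage of [A] in [Omega].  It has the same finite measure as [A],
   so it is enough to bound the measure of [A `\` X], which misses the core. *)
Let L2_continuous_at0_open (A : set V) : open A -> A `<=` Omega -> (leb A < +oo)%E ->
  L2_continuous_at0 (cindic A).
Proof.
move=> oA AO Aoo e e0.
have mA : measurable A by exact: open_measurable_cV.
have e2 : 0 < e / 2 by rewrite divr_gt0.
have [r r0 rA] := open_core_exhausts oA Aoo e2.
apply/nbhs_ballP; exists r => //= t t0r.
pose X := Omega `&` phi t @^-1` A.
have mX : measurable X.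
  apply: measurableI => //; rewrite -[X in measurable X]setTI.
  exact: (preserves_measurable (pphi t)).
have XA : leb X = leb A.
  by rewrite (preserves_measureE (pphi t))// setIidr.
have AX : (leb (A `\` X) <= (e / 2)%:E)%E.
  apply: le_trans rA; apply: le_measure; rewrite ?inE.
  - exact: measurableD.
  - by apply: measurableD => //; exact: measurable_core.
  move=> x [Ax nXx]; split=> // -[_ nb]; apply: nXx.
  have Axt : A (x + t).
    apply: contrapT => nA; apply: nb; exists (x + t) => //.
    move: t0r; rewrite -!ball_normE/= sub0r normrN.
    by rewrite addrAC subrr add0r.
  by split; [exact: AO|rewrite /= /tile_shift_map tile_id//; exact: AO].
have XAE : leb (X `\` A) = leb (A `\` X).
  have Xfin : leb (X `&` A) \is a fin_num.
    rewrite ge0_fin_numE ?measure_ge0//; apply: le_lt_trans Aoo.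
    by apply: le_measure; rewrite ?inE//; exact: measurableI.
  have := XA; rewrite (measureDI leb mX mA) (measureDI leb mA mX).
  rewrite (setIC A X) => /eqP.
  by rewrite eq_le !leeD2rE// -eq_le => /eqP.
rewrite (_ : L2sq _ _ _ = L2sq leb Omega (cindic ((X `\` A) `|` (A `\` X)))).
  rewrite L2sq_cindic//; last by apply: measurableU; exact: measurableD.
  rewrite setIidl; last by move=> x [[[]]|[/AO]].
  apply: (@le_trans _ _ (leb (X `\` A) + leb (A `\` X))%E).
    by apply: measureU2; exact: measurableD.
  by rewrite XAE (splitr e) EFinD leeD.
apply: eq_integral => x /set_mem Ox.
rewrite /tile_translation /cindic /creal.
have -> : \1_A (tile (x + t)) = \1_X x :> R.
  rewrite !indicE; congr (nat_of_bool _)%:R.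
  apply/idP/idP => /set_mem; rewrite /X/= /tile_shift_map => h; apply/mem_set => //.
  by case: h.
congr EFin; rewrite /sqnorm/= subr0 !indicE in_setU !in_setD.
by case: (x \in A); case: (x \in X) => /=; rewrite ?subrr ?subr0 ?sub0r ?sqrrN ?expr1n ?expr0n/= ?addr0.
Qed.

Let cindicU (A B : set V) : A `&` B = set0 ->
  cindic (A `|` B) = (fun x => 1 * cindic A x + cindic B x) :> (V -> R[i]).
Proof.
move=> AB; apply/funext => x; rewrite mul1r /cindic /creal !indicE in_setU.
have nAB : ~ (A `&` B) x by rewrite AB.
have [/set_mem Ax|_] := boolP (x \in A);
    have [/set_mem Bx|_] := boolP (x \in B) => /=.
- by case: nAB.
- by apply/eqP; rewrite eq_complex/= !addr0 !eqxx.
- by apply/eqP; rewrite eq_complex/= add0r addr0 !eqxx.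
- by apply/eqP; rewrite eq_complex/= !addr0 !eqxx.
Qed.

(** Intersecting with a fixed open [W] of finite measure makes the class of good
   Borel sets [B] stable under complement; it is then a Dynkin class containing
   the open sets. *)
Let L2_continuous_at0_cap (W B : set V) : open W -> W `<=` Omega ->
  (leb W < +oo)%E -> measurable B -> L2_continuous_at0 (cindic (B `&` W)).
Proof.
move=> oW WO Woo.
have mW : measurable W by exact: open_measurable_cV.
have Boo (A : set V) : measurable A -> (leb (A `&` W) < +oo)%E.
  move=> mA; apply: le_lt_trans Woo.
  by apply: le_measure; rewrite ?inE//; exact: measurableI.
have BL (A : set V) : measurable A -> cLp leb 2%:E Omega (cindic (A `&` W)).
  move=> mA; apply: (cLp2_cindic mOmega); first exact: measurableI.
  rewrite setIidl; first exact: Boo.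
  by move=> x [_ /WO].
have Popen (A : set V) : open A -> L2_continuous_at0 (cindic (A `&` W)).
  move=> oA; apply: L2_continuous_at0_open.
  - exact: openI.
  - by move=> x [_ /WO].
  - by apply: Boo; exact: open_measurable_cV.
have sub_disj (A C : set V) : measurable A -> measurable C -> A `<=` C ->
    cindic (C `&` W) = (fun x => 1 * cindic (A `&` W) x + cindic ((C `\` A) `&` W) x)
     :> (V -> R[i]).
  move=> mA mC AC; rewrite -cindicU -?setIUl ?setDUK//.
  by rewrite setIACA setDIK set0I.
apply: (@dynkin_induction _ _ (@open V) (fun B => L2_continuous_at0 (cindic (B `&` W)))) => //.
- exact: openI.
- by apply: Popen; exact: openT.
- move=> A mA PA.
  rewrite (_ : cindic (~` A `&` W) =
      (fun x => -1 * cindic (A `&` W) x + cindic (setT `&` W) x)); last first.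
    rewrite (sub_disj A setT)// setTD; apply/funext => x.
    by rewrite mul1r mulN1r addKr.
  apply: L2_continuous_at0_comb => //; [exact: BL|exact: BL|by apply: Popen; exact: openT].
- move=> F mF tF PF.
  have mS n : measurable (\big[setU/set0]_(k < n) F k) by exact: bigsetU_measurable.
  have mU : measurable (\bigcup_k F k) by exact: bigcupT_measurable.
  have PS n : L2_continuous_at0 (cindic ((\big[setU/set0]_(k < n) F k) `&` W)).
    elim: n => [|n IHn]; first by rewrite big_ord0; by apply: Popen; exact: open0.
    rewrite big_ord_recr/= (sub_disj (\big[setU/set0]_(k < n) F k))//.
    + rewrite setDUl setDv set0U.
      rewrite (_ : F n `\` _ = F n).
        by apply: L2_continuous_at0_comb => //; exact: BL.
      apply/seteqP; split=> [x []//|x Fx]; split=> //.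
      rewrite -bigcup_mkord => -[k /= kn Fkx].
      have kE : k = n by apply: (tF k n) => //; exists x.
      by move: kn; rewrite kE ltnn.
    + by apply: measurableU; [exact: mS|exact: mF].
  apply: L2_continuous_at0_closed; first exact: BL.
  move=> e e0.
  pose G n := (\bigcup_k F k `\` \big[setU/set0]_(k < n) F k) `&` W.
  have mG n : measurable (G n) by apply: measurableI => //; exact: measurableD.
  have G0 : \bigcap_n G n = set0.
    apply/eqP/negPn/negP => /set0P[x Gx].
    have [[[k _ Fx] _] _] := Gx 0%N I.
    have [[_ nx] _] := Gx k.+1 I; apply: nx.
    by rewrite -bigcup_mkord; exists k => /=.
  have : leb \o G @ \oo --> 0%E.
    rewrite -(measure0 leb) -G0; apply: nonincreasing_cvg_mu => //.
    - by apply: Boo; exact: measurableD.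
    - by rewrite G0.
    - move=> m n mn; apply/subsetPset; apply: setSI; apply: setDS.
      rewrite -!bigcup_mkord; apply: bigcup_subset => k /=.
      by move/leq_trans; exact.
  move=> /(_ [set y | (y < e%:E)%E]) [|n _ hn].
    apply: open_nbhs_nbhs; split; first exact: open_ereal_lt_ereal.
    by rewrite /= lte_fin.
  exists (cindic ((\big[setU/set0]_(k < n) F k) `&` W)); split; first exact: BL.
    exact: PS.
  rewrite (_ : (fun x => _) = cindic (G n)).
    rewrite L2sq_cindic// setIidl; first by apply/ltW/(hn n) => /=.
    by move=> x [_ /WO].
  have SU : \big[setU/set0]_(k < n) F k `<=` \bigcup_k F k.
    by rewrite -bigcup_mkord => x [k _ Fx]; exists k.
  rewrite (sub_disj _ _ (mS n) mU SU).
  by apply/funext => x; rewrite mul1r addrAC subrr add0r.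
Qed.

(** A set of finite measure is approximated by its intersections with larger and
    larger balls. *)
Lemma L2_continuous_at0_cindic (B : set V) : measurable B -> B `<=` Omega ->
  (leb B < +oo)%E -> L2_continuous_at0 (cindic B).
Proof.
move=> mB BO Boo.
pose W n : set V := Omega `&` ball (0 : V) n.+1%:R.
have oW n : open (W n) by apply: openI => //; exact: ball_open.
have mW n : measurable (W n) by exact: open_measurable_cV.
have WO n : W n `<=` Omega by move=> x [].
have Woo n : (leb (W n) < +oo)%E.
  apply: (@le_lt_trans _ _ (leb (ball (0%R : V) n.+1%:R))).
    apply: le_measure; rewrite ?inE//; last by move=> x [].
    by apply: open_measurable_cV; exact: ball_open.
  by rewrite lebesgue_cV_ball// ltry.
have BL : cLp leb 2%:E Omega (cindic B).
  by apply: (cLp2_cindic mOmega) => //; rewrite setIidl.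
apply: L2_continuous_at0_closed => // e e0.
pose G n := B `\` W n.
have mG n : measurable (G n) by exact: measurableD.
have G0 : \bigcap_n G n = set0.
  apply/eqP/negPn/negP => /set0P[x Gx].
  have [Bx _] := Gx 0%N I.
  pose n := Num.truncn `|x|.
  have [_] := Gx n I; apply; split; first exact: BO.
  by rewrite -ball_normE/= sub0r normrN truncnS_gt.
have : leb \o G @ \oo --> 0%E.
  rewrite -(measure0 leb) -G0; apply: nonincreasing_cvg_mu => //.
  - apply: le_lt_trans Boo; apply: le_measure; rewrite ?inE//; exact: subDsetl.
  - by rewrite G0.
  - move=> m n mn; apply/subsetPset; apply: setDS; apply: setIS.
    by apply: le_ball; rewrite ler_nat ltnS.
move=> /(_ [set y | (y < e%:E)%E]) [|n _ hn].
  apply: open_nbhs_nbhs; split; first exact: open_ereal_lt_ereal.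
  by rewrite /= lte_fin.
exists (cindic (B `&` W n)); split.
- apply: (cLp2_cindic mOmega); first exact: measurableI.
  rewrite setIidl; last by move=> x [/BO].
  by apply: le_lt_trans Boo; apply: le_measure; rewrite ?inE//; exact: measurableI.
- exact: L2_continuous_at0_cap.
rewrite (_ : (fun x => _) = cindic (G n)).
  rewrite L2sq_cindic// setIidl; first by apply/ltW/(hn n) => /=.
  by move=> x [/BO].
apply/funext => x; rewrite /G /cindic /creal !indicE in_setI in_setD.
by case: (x \in B); case: (x \in W n); apply/eqP;
  rewrite eq_complex/= ?subrr ?subr0 !eqxx.
Qed.

Lemma L2_continuous_at0_L2 f : cLp leb 2%:E Omega f -> L2_continuous_at0 f.
Proof.
apply: (cLp2_ind mOmega).
- exact: L2_continuous_at0_comb.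
- exact: L2_continuous_at0_closed.
- exact: L2_continuous_at0_cindic.
Qed.

(** The difference at times [t] and [t0] is the image under the isometry [U t0]
    of the difference at times [t - t0] and [0]. *)
Lemma L2sq_tile_translationB t t0 f : cmeasurable Omega f ->
  L2sq leb Omega (fun x => U t f x - U t0 f x) =
  L2sq leb Omega (fun x => U (t - t0) f x - f x).
Proof.
move=> mf.
have mh := cmeasurableB (tile_translation_measurable (t - t0) mf) mf.
rewrite -[RHS](L2sq_tile_translation t0 mh); apply: ae_eq_L2sq => //.
- by apply: cmeasurableB; exact: tile_translation_measurable.
- exact: tile_translation_measurable.
- apply: filterS (tile_translationD t0 (t - t0) f) => x xE _.
  transitivity (U t0 (U (t - t0) f) x - U t0 f x); last by [].
  by rewrite xE (addrC t0) subrK.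
Qed.

Lemma strongly_continuous_tile_translation f t0 : cLp leb 2%:E Omega f ->
  cLnorm leb 2%:E Omega (fun x => U t f x - U t0 f x) @[t --> t0] --> 0%E.
Proof.
move=> fL; have [mf _] := fL.
have near_le (e : R) : 0 < e -> \forall t \near t0,
    (cLnorm leb 2%:E Omega (fun x => U t f x - U t0 f x)%R <= e%:E)%E.
  move=> e0; have e2 : 0 < e ^+ 2 by rewrite exprn_gt0.
  have /nbhs_ballP[r /= r0 rP] := L2_continuous_at0_L2 fL e2.
  apply/nbhs_ballP; exists r => //= t tr.
  rewrite cLnorm2E L2sq_tile_translationB//.
  have -> : e%:E = ((e ^+ 2)%:E `^ 2^-1)%E.
    by rewrite poweR_EFin -powR_mulrn ?ltW// -powRrM divff// powRr1// ltW.
  apply: gt0_ler_poweR => //; rewrite ?in_itv/= ?leey ?L2sq_ge0 ?lee_fin ?(ltW e2)//.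
  apply: rP; move: tr; rewrite -!ball_normE/= sub0r normrN.
  by rewrite distrC.
pose N t := cLnorm leb 2%:E Omega (fun x => U t f x - U t0 f x)%R.
have fin : \forall t \near t0, N t \is a fin_num.
  near=> t; rewrite ge0_fin_numE; last exact: Lnorm_ge0.
  apply: (@le_lt_trans _ _ 1%:E); last by rewrite ltry.
  by near: t; exact: near_le.
apply/(@fine_cvgP _ _ (nbhs t0) _ N); split; first exact: fin.
apply/cvgr0Pnorm_le => e e0; near=> t.
rewrite /= ger0_norm ?fine_ge0 ?Lnorm_ge0// -lee_fin fineK.
  by near: t; exact: near_le.
by near: t; exact: fin.
Unshelve. all: by end_near. Qed.

Lemma local_translation_group_tile_translation :
  local_translation_group Omega U.
Proof.
split.
- exact: unitary_tile_translation.
- by move=> f _; apply: aeW => x; exact: tile_translation0.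
- by move=> s t f _; apply: filterS (tile_translationD s t f) => x ->.
- by move=> f t0; exact: strongly_continuous_tile_translation.
- move=> A t f _ AO AtO _; apply: aeW => x; exact: tile_translation_local.
Qed.

End translation_group.

(** * Characters and the dual lattice *)

Section characters.
Context (R : realType) (d : nat).
Local Notation V := 'cV[R]_d.
Implicit Types (a b : R) (l x y : V).

Lemma cisD a b : cis (a + b) = cis a * cis b :> R[i].
Proof.
rewrite /cis mulrDr cosD sinD; apply/eqP; rewrite eq_complex/= eqxx/=.
by rewrite addrC.
Qed.

Lemma cis0 : cis 0 = 1 :> R[i].
Proof. by rewrite /cis mulr0 cos0 sin0. Qed.

Lemma sqnorm_cis a : sqnorm (cis a) = 1.
Proof. by rewrite /sqnorm/= cos2Dsin2. Qed.

Lemma cis_int a : a \is a Num.int -> cis a = 1.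
Proof.
have cis1 : cis (1 : R) = 1.
  by rewrite /cis mulr1 mulr_natl cos2pi sin2pi.
have cisn n : cis (n%:R : R) = 1.
  by elim: n => [|n IHn]; rewrite ?cis0// -addn1 natrD cisD IHn cis1 mulr1.
move=> /intrP[[n ->|n ->]]; first exact: cisn.
rewrite NegzE -[LHS]mulr1 -(cisn n.+1) -cisD mulrNz addNr.
by rewrite cis0 cisn.
Qed.

Lemma dotDr l x y : dot l (x + y) = dot l x + dot l y.
Proof.
by rewrite /dot -big_split/=; apply: eq_bigr => i _; rewrite mxE mulrDr.
Qed.

Lemma dotNr l x : dot l (- x) = - dot l x.
Proof.
by rewrite /dot -sumrN; apply: eq_bigr => i _; rewrite mxE mulrN.
Qed.

Lemma measurable_dotl t : measurable_fun setT (fun l => dot l t).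
Proof.
apply: measurable_sum => i; apply: measurable_funM => //.
exact: measurable_coord.
Qed.

Lemma measurable_dotr l : measurable_fun setT (fun x => dot l x).
Proof.
apply: measurable_sum => i; apply: measurable_funM => //.
exact: measurable_coord.
Qed.

Lemma cmeasurable_cis (D : set V) (h : V -> R) :
  measurable_fun setT h -> cmeasurable D (fun x => cis (h x)).
Proof.
move=> mh; have m2h : measurable_fun setT (fun x => 2 * pi * h x).
  by apply: measurable_funM.
split; apply: measurable_funTS.
- by apply: (measurableT_comp _ m2h); apply: continuous_measurable_fun; exact: continuous_cos.
- by apply: (measurableT_comp _ m2h); apply: continuous_measurable_fun; exact: continuous_sin.
Qed.

End characters.

Section dual_lattice.
Context (R : realType) (d d1 d2 : nat) (e : (d1 + d2)%N = d) (A : 'M[R]_d).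
Hypothesis uA : A \in unitmx.
Local Notation V := 'cV[R]_d.

Let row1 (w : V) : 'cV[R]_d1 := \col_i w (cast_ord e (lshift d2 i)) 0.

Let row1_join p : row1 (join_cV e p) = p.1.
Proof.
apply/matrixP => i j; rewrite !ord1 mxE castmxE cast_ordK.
rewrite (_ : cast_ord _ 0 = 0) ?col_mxEu//.
exact/val_inj.
Qed.

Let dot_join0 (w : V) z : dot w (join_cV e (z, 0)) = dot (row1 w) z.
Proof.
have E : forall i, join_cV e (z, 0) (cast_ord e i) 0 = (col_mx z (0 : 'cV_d2)) i 0.
  move=> i; rewrite castmxE cast_ordK; congr (col_mx _ _ _ _); exact/val_inj.
rewrite /dot (reindex_onto (cast_ord e) (cast_ord (esym e))) /=; last first.
  by move=> i _; rewrite cast_ordKV.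
under eq_bigl do rewrite cast_ordK eqxx.
rewrite big_split_ord/= [X in _ + X]big1 ?addr0.
  by apply: eq_bigr => i _; rewrite E col_mxEu mxE.
by move=> i _; rewrite E col_mxEd mxE mulr0.
Qed.

Let dot_mulmx (l v : V) : dot l (A *m v) = dot (A^T *m l) v.
Proof.
have dE (x y : V) : dot x y = (x^T *m y) 0 0.
  by rewrite mxE; apply: eq_bigr => i _; rewrite mxE.
by rewrite !dE trmx_mul trmxK mulmxA.
Qed.

(** Membership in the dual set only depends on the first block of [A^T l], and
    the counting factor of the measure charges only integer blocks. *)
Lemma ae_dual_lattice :
  {ae lattice_measure e A, forall l, dual_set (lattice e A) l}.
Proof.
have mrow1 : measurable_fun setT (fun l : V => row1 (A^T *m l)).
  apply: measurable_fun_cV => i; under eq_fun do rewrite !mxE.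
  apply: measurable_sum => j; apply: measurable_funM => //.
  exact: measurable_coord.
pose N := (fun l : V => row1 (A^T *m l)) @^-1` (~` @integer_points R d1).
exists N; split.
- rewrite -[X in measurable X]setTI; apply: mrow1 => //.
  by apply: measurableC; exact: measurable_integer_points.
- rewrite /= /lattice_measure.
  have -> : [set p | N (invmx A^T *m join_cV e p)] =
      (~` @integer_points R d1) `*` setT.
    apply/seteqP; split=> p; rewrite /N/= mulKVmx ?unitmx_tr// row1_join//.
    by case.
  have mZ : measurable (~` @integer_points R d1).
    by apply: measurableC; exact: measurable_integer_points.
  rewrite /integer_lebesgue [X in (_ * X)%E](product_measure1E _ _ mZ measurableT).
  by rewrite /= /mrestr setICl measure0 mul0e mule0.
- move=> l /= nl Zl; apply: nl => _ [z zZ <-].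
  rewrite dot_mulmx dot_join0 /dot.
  by apply: rpred_sum => i _; apply: rpredM; [exact: Zl|exact: zZ].
Qed.

End dual_lattice.

(** * The Fourier transform of a translation *)

Section cintegral_theory.
Context d (X : measurableType d) (R : realType).
Variables (mu : {measure set X -> \bar R}) (D : set X) (mD : measurable D).
Implicit Types f g : X -> R[i].

Lemma ae_eq_cintegral f g : cmeasurable D f -> cmeasurable D g ->
  f = g %[ae mu in D] -> cintegral mu D f = cintegral mu D g.
Proof.
move=> [f1 f2] [g1 g2] fg; rewrite /cintegral /Rintegral.
congr (Complex (fine _) (fine _)); apply: ae_eq_integral => //;
  try exact/measurable_EFinP; by apply: filterS fg => x fg /fg ->.
Qed.

Lemma cintegralZ (c : R[i]) f : cLp mu 1%:E D f ->
  cintegral mu D (fun x => c * f x) = c * cintegral mu D f.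
Proof.
move=> [mf]; rewrite cLnorm1E => foo; have [mRe mIm] := mf.
have mn := measurable_normc mf.
have normcE z : normc z = Num.sqrt (sqnorm z) :> R.
  by rewrite -sqr_normc_sqnorm sqrtr_sqr ger0_norm ?normc_ge0.
have part_integrable (r : R[i] -> R) :
    measurable_fun D (fun x => r (f x)) -> (forall z, r z ^+ 2 <= sqnorm z) ->
    mu.-integrable D (EFin \o (fun x => r (f x))).
  move=> mr rn; apply/integrableP; split; first exact/measurable_EFinP.
  apply: le_lt_trans foo; apply: ge0_le_integral => //.
  - by apply/measurable_EFinP; apply: measurableT_comp.
  - exact/measurable_EFinP.
  move=> x _; rewrite /= lee_fin normcE -sqrtr_sqr.
  by rewrite ler_wsqrtr// rn.
have iRe : mu.-integrable D (EFin \o (fun x => complex.Re (f x))).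
  by apply: (part_integrable (@complex.Re R)) => // z; rewrite lerDl sqr_ge0.
have iIm : mu.-integrable D (EFin \o (fun x => complex.Im (f x))).
  by apply: (part_integrable (@complex.Im R)) => // z; rewrite lerDr sqr_ge0.
case: c => a b; rewrite /cintegral; apply/eqP; rewrite eq_complex/=.
have iZ (r : R) h : mu.-integrable D (EFin \o h) ->
    mu.-integrable D (EFin \o (fun x => r * h x)).
  by move=> ih; exact: (integrableZl mD r ih).
rewrite -!RintegralZl// -RintegralB// -?RintegralD//; try exact: iZ.
apply/andP; split; apply/eqP; apply: eq_Rintegral => x _.
- by rewrite complexReM.
- by rewrite complexImM.
Qed.

End cintegral_theory.

Section fourier.
Context (R : realType) (d : nat) (Omega T : set 'cV[R]_d).
Hypothesis openOmega : open Omega.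
Hypothesis subgroupT : discrete_subgroup T.
Hypothesis tilesOmega : tiles Omega T.
Local Notation leb := (lebesgue_cV R d).
Local Notation V := 'cV[R]_d.
Local Notation U := (tile_translation Omega T).

Let mOmega : measurable Omega. Proof. exact: open_measurable_cV. Qed.

Let pphi t : preserves_measure leb Omega (tile_shift_map Omega T t).
Proof. exact: preserves_measure_tile_shift. Qed.

(** A character of a dual frequency is [T]-periodic, so it may be evaluated at
    [y(x + t)] in place of [x + t]; then [phi_t] is a change of variables. *)
Lemma fourier_integral_tile_translation f (l t : V) :
  dual_set T l -> cLp leb 1%:E Omega f ->
  fourier_integral Omega (U t f) l = cis (dot l t) * fourier_integral Omega f l.
Proof.
move=> Tl [mf f1].
pose k (y : V) : R[i] := f y * cis (- dot l y).
have mcis : cmeasurable Omega (fun x => cis (- dot l x)).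
  apply: cmeasurable_cis; apply: measurableT_comp => //.
  exact: measurable_dotr.
have mk : cmeasurable Omega k by exact: cmeasurableM.
have mck : cmeasurable Omega (fun y => cis (dot l t) * k y).
  by apply: cmeasurableM => //; exact: cmeasurable_cst.
have kL : cLp leb 1%:E Omega k.
  split=> //; rewrite cLnorm1E; move: f1; rewrite cLnorm1E.
  congr (_ < _)%E; apply: eq_integral => x _; congr EFin; rewrite /k normcM.
  rewrite (_ : normc (cis _) = 1) ?mulr1//.
  by apply/eqP; rewrite -sqrp_eq1 ?normc_ge0// sqr_normc_sqnorm sqnorm_cis.
rewrite /fourier_integral -(cintegralZ mOmega _ kL).
rewrite -(cintegral_preserving mOmega (pphi t) mck).
apply: ae_eq_cintegral => //.
- apply: cmeasurableM => //.
  exact: (cmeasurable_preserving mOmega (pphi t)).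
- exact: (cmeasurable_preserving mOmega (pphi t)).
apply: filterS (ae_tiled_shift openOmega tilesOmega t) => x tx _.
have [_ Tg] := tile_pointP openOmega tilesOmega tx.
rewrite /k /tile_translation /= /tile_shift_map mulrCA; congr (_ * _).
rewrite -cisD -(mulr1 (cis (- _))) -(cis_int (Tl _ Tg)) -cisD; congr cis.
by rewrite !(dotDr, dotNr); ring.
Qed.

Variables (nu : {measure set V -> \bar R}).
Hypothesis ae_dual : {ae nu, forall l, dual_set T l}.
Variable F : (V -> R[i]) -> (V -> R[i]).
Hypothesis FP : pair_transform Omega nu F.

Let Flin := isometric_isomorphism_linear (pair_transform_iso FP).

Let L2sqF f : cLp leb 2%:E Omega f -> L2sq nu setT (F f) = L2sq leb Omega f.
Proof.
move=> fL; rewrite -!sqr_cLnorm2.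
by rewrite (isometric_isomorphism_norm (pair_transform_iso FP) fL).
Qed.

Let UL t f : cLp leb 2%:E Omega f -> cLp leb 2%:E Omega (U t f).
Proof. exact: (cLp2_preserving mOmega (pphi t)). Qed.

Let intertwines t f := F (U t f) = (fun l => cis (dot l t) * F f l) %[ae nu].

Let intertwines_comb t (a : R[i]) f g :
  cLp leb 2%:E Omega f -> cLp leb 2%:E Omega g ->
  intertwines t f -> intertwines t g ->
  intertwines t (fun x => a * f x + g x).
Proof.
move=> fL gL If Ig.
have H1 := L2_linear_comb Flin a (UL t fL) (UL t gL).
have H2 := L2_linear_comb Flin a fL gL.
near=> l => _.
transitivity (a * F (U t f) l + F (U t g) l); first by apply: (near H1 l).
rewrite (near If l)// (near Ig l)// (near H2 l)//; ring.
Unshelve. all: by end_near. Qed.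

Let intertwines_cindic t (B : set V) : measurable B -> B `<=` Omega ->
  (leb B < +oo)%E -> intertwines t (cindic B).
Proof.
move=> mB BO Boo.
have B2 : cLp leb 2%:E Omega (cindic B).
  by apply: cLp2_cindic => //; rewrite setIidl.
have B1 : cLp leb 1%:E Omega (cindic B).
  split; first by case: B2.
  rewrite cLnorm1E (_ : \int[_]_(x in _) _ = L2sq leb Omega (cindic B))%E.
    by rewrite L2sq_cindic// setIidl.
  apply: eq_integral => x _; congr EFin.
  rewrite -sqr_normc_sqnorm /cindic /creal /normc/= indicE expr0n/= addr0.
  by case: (_ \in _); rewrite ?expr1n ?expr0n/= ?sqrtr1 ?sqrtr0 ?expr1n ?expr0n.
have H1 := pair_transform_integral FP B1 B2.
have H2 := pair_transform_integral FP (cLp1_preserving mOmega (pphi t) B1)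
  (UL t B2).
near=> l => _.
rewrite (near H1 l)//.
transitivity (fourier_integral Omega (U t (cindic B)) l).
  by apply: (near H2 l).
apply: fourier_integral_tile_translation => //.
by near: l.
Unshelve. all: by end_near. Qed.

(** With [w = f - g], the defect of [f] equals the defect of [w] almost
   everywhere, and the squared norm of the latter is at most
   [2 |w|^2 + 2 |w|^2] since [F] and [U t] are isometric and the factor [cis] has
   modulus one. *)
Let intertwines_closed t f : cLp leb 2%:E Omega f ->
  (forall e : R, 0 < e -> exists g, [/\ cLp leb 2%:E Omega g,
    intertwines t g & (L2sq leb Omega (fun x => f x - g x)%R <= e%:E)%E]) ->
  intertwines t f.
Proof.
move=> fL fg.
pose h l := F (U t f) l - cis (dot l t) * F f l.
have [mFUf _] := L2_linear_range Flin (UL t fL).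
have [mFf _] := L2_linear_range Flin fL.
have mcis : cmeasurable setT (fun l => cis (dot l t)).
  apply: cmeasurable_cis; exact: measurable_dotl.
have mh : cmeasurable setT h by apply: cmeasurableB => //; exact: cmeasurableM.
suff h0 : L2sq nu setT h = 0%E.
  apply: filterS (L2sq_eq0 measurableT mh h0) => l /[apply] /eqP.
  by rewrite subr_eq0 => /eqP.
apply/eqP; rewrite eq_le L2sq_ge0 andbT.
apply/lee_addgt0Pr => e e0; rewrite add0e.
have e4 : 0 < e / 4 by rewrite divr_gt0.
have [g [gL Ig ge]] := fg _ e4.
pose w x := -1 * g x + f x.
have wL : cLp leb 2%:E Omega w by exact: cLp2_comb.
have H1 := L2_linear_comb Flin (-1) (UL t gL) (UL t fL).
have H2 := L2_linear_comb Flin (-1) gL fL.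
have [mFUw _] := L2_linear_range Flin (UL t wL).
have [mFw _] := L2_linear_range Flin wL.
have mcFw : cmeasurable setT (fun l => - (cis (dot l t) * F w l)).
  by apply: cmeasurableN; exact: cmeasurableM.
rewrite (@ae_eq_L2sq _ _ _ _ _ measurableT _
  (fun l => F (U t w) l + - (cis (dot l t) * F w l))%R mh); first last.
- near=> l => _.
  have -> : F (U t w) l = -1 * F (U t g) l + F (U t f) l by apply: (near H1 l).
  have -> : F w l = -1 * F g l + F f l by apply: (near H2 l).
  rewrite (near Ig l)// /h; ring.
- exact: cmeasurableD.
apply: le_trans (L2sqD nu measurableT mFUw mcFw) _.
rewrite (_ : L2sq nu setT (fun l => - (cis (dot l t) * F w l))%R =
             L2sq nu setT (F w)); last first.
  by apply: eq_integral => l _; rewrite sqnormN sqnormM sqnorm_cis mul1r.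
rewrite !L2sqF//; last exact: UL.
have [mw _] := wL.
rewrite (L2sq_preserving mOmega (pphi t) mw).
rewrite (_ : L2sq leb Omega w = L2sq leb Omega (fun x => f x - g x)%R); last first.
  by apply: eq_L2sq => x _; rewrite /w mulN1r addrC.
rewrite -ge0_muleDl ?lee_fin// -EFinD.
have -> : e = (2 + 2) * (e / 4) by field.
by rewrite EFinM lee_pmul2l// lte_fin.
Unshelve. all: by end_near. Qed.

Lemma pair_transform_tile_translation t f : cLp leb 2%:E Omega f ->
  F (U t f) = (fun l => cis (dot l t) * F f l) %[ae nu].
Proof.
apply: (cLp2_ind mOmega (P := intertwines t)).
- by move=> *; exact: intertwines_comb.
- exact: intertwines_closed.
- exact: intertwines_cindic.
Qed.

End fourier.

Theorem proposition5p9 (R : realType) (d : nat) (Omega T : set 'cV[R]_d)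
    (openOmega : open Omega) (subgroupT : discrete_subgroup T)
    (tilesOmega : tiles Omega T) :
  [/\ {ae lebesgue_cV R d, forall x,
        [/\ Omega (tile_point Omega T x), T (tile_shift Omega T x),
          x = tile_point Omega T x + tile_shift Omega T x &
          forall y g, Omega y -> T g -> x = y + g ->
            y = tile_point Omega T x /\ g = tile_shift Omega T x]},
    local_translation_group Omega (tile_translation Omega T) &
    forall (d1 d2 : nat) (e : (d1 + d2)%N = d) (A : 'M[R]_d),
      A \in unitmx -> T = lattice e A ->
      forall F : ('cV[R]_d -> R[i]) -> ('cV[R]_d -> R[i]),
      pair_transform Omega (lattice_measure e A) F ->
      forall (t : 'cV[R]_d) (f : 'cV[R]_d -> R[i]),
      cLp (lebesgue_cV R d) 2%:E Omega f ->
      {ae lattice_measure e A, forall l, dual_set T l /\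
        F (tile_translation Omega T t f) l = cis (dot l t) * F f l}].
Proof.
split.
- exists (~` tiled Omega T); split.
  + by apply: measurableC; exact: measurable_tiled.
  + exact: untiled_null.
  move=> x /= nx tx; apply: nx.
  have [Ox Tx] := tile_pointP openOmega tilesOmega tx.
  have xE : x = tile_point Omega T x + tile_shift Omega T x.
    by rewrite /tile_shift addrC subrK.
  split=> // y g Oy Tg xyg.
  by apply: (tiles_unique openOmega tilesOmega) => //; rewrite -xyg.
- exact: local_translation_group_tile_translation.
- move=> d1 d2 e A uA TE F FP t f fL.
  have dualT : {ae lattice_measure e A, forall l, dual_set T l}.
    by rewrite TE; exact: ae_dual_lattice.
  have H := pair_transform_tile_translation openOmega subgroupT tilesOmega
    dualT FP t fL.
  by near=> l; split; [near: l|apply: (near H l)].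
Unshelve. all: by end_near. Qed.
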